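(* Let $\mathcal O$ be a straight $W$-conjugacy class of $\tilde W$. Then for any $\tilde w,\tilde w'\in\mathcal O_{\min}$ we have $\tilde w\approx\tilde w'$.
   Context: Setting: $W=Q\rtimes W_0$ affine Weyl group of a reduced root system (Coxeter group with affine simple reflections $S$), $\tilde W=P\rtimes(W_0\rtimes\Omega')$ for a connected complex reductive group with coweight lattice $P$ and finite group $\Omega'$ of diagram automorphisms; $\ell$ the length on $\tilde W$ (number of affine root hyperplanes separating the fundamental alcove from its image). $\mathcal O_{\min}$ = elements of minimal length in $\mathcal O$. $\tilde w$ is straight if $\ell(\tilde w^m)=m\ell(\tilde w)$ for all $m\ge0$; a class is straight if it contains a straight element. For $s\in S$, $w\xrightarrow{s}w'$ means $w'=sws$ and $\ell(w')\le\ell(w)$; $w\to w'$ means a finite chain of such steps; $w\approx w'$ means $w\to w'$ and $w'\to w$. *)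

(* Defs.v *)
(* Extended affine Weyl group of a based root datum, realised
   concretely on the cocharacter lattice Y = Z^n (row vectors), with the
   apartment Y (x) Q = Q^n. *)
From HB Require Import structures.
From mathcomp Require Import all_boot all_order all_algebra.
From Stdlib Require Import ClassicalEpsilon.
Set Implicit Arguments. Unset Strict Implicit. Unset Printing Implicit Defensive.
Import Order.TTheory GRing.Theory Num.Theory.
Local Open Scope ring_scope.

Section AffineWeyl.
Variable n : nat.
Notation vec := 'rV[int]_n.
Notation mat := 'M[int]_n.
Notation datum := (seq (vec * vec)).

(* perfect pairing X x Y -> Z, X = Y = Z^n *)
Definition pairing (x y : vec) : int := \sum_(i < n) x 0 i * y 0 i.
Definition intr (z : int) : rat := z%:~R.
Definition pairQ (x : vec) (p : 'rV[rat]_n) : rat := \sum_(i < n) intr (x 0 i) * p 0 i.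

(* a root datum: list of pairs (root alpha, coroot alpha^vee) *)
Definition is_root_datum (rd : seq (vec * vec)) : Prop :=
  [/\ uniq (map fst rd), uniq (map snd rd),
      (forall a, a \in rd -> pairing a.1 a.2 = 2) &
      (forall a b, a \in rd -> b \in rd ->
         (b.1 - pairing b.1 a.2 *: a.1, b.2 - pairing a.1 b.2 *: a.2) \in rd)].

Definition reduced (rd : seq (vec * vec)) : Prop :=
  forall a, a \in rd -> (2%:Z *: a.1) \notin map fst rd.

(* v determines the positive system: alpha > 0 iff <alpha, v> > 0 *)
Definition regular (rd : seq (vec * vec)) (v : vec) : Prop :=
  forall a, a \in rd -> pairing a.1 v != 0.
Definition positive (v : vec) (a : vec * vec) : bool := 0 < pairing a.1 v.

(* elements (lambda, w) act by p |-> p w + lambda, i.e. t^lambda w *)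
Definition elt := (vec * mat)%type.
Definition mul (x y : elt) : elt := (y.1 *m x.2 + x.1, y.2 *m x.2).
Definition one : elt := (0, 1%:M).
Definition inv (x : elt) : elt := (- (x.1 *m invmx x.2), invmx x.2).
Definition pow (x : elt) (m : nat) : elt := iter m (mul x) one.
Definition act (x : elt) (p : 'rV[rat]_n) : 'rV[rat]_n :=
  p *m map_mx intr x.2 + map_mx intr x.1.

(* reflection s_alpha on Y : y |-> y - <alpha,y> alpha^vee *)
Definition sref (a : vec * vec) : mat := 1%:M - a.1^T *m a.2.

Inductive inW0 (rd : seq (vec * vec)) : mat -> Prop :=
| W0_one : inW0 rd 1%:M
| W0_mul a w : a \in rd -> inW0 rd w -> inW0 rd (w *m sref a).

Inductive inQ (rd : seq (vec * vec)) : vec -> Prop :=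
| Q_zero : inQ rd 0
| Q_add a l : a \in rd -> inQ rd l -> inQ rd (l + a.2).

(* Omega' : finite group of diagram automorphisms (automorphisms of the based
   root datum); w acts on Y by y |-> y w and on X by x |-> x (w^-1)^T. *)
Definition is_diagram_group (rd : seq (vec * vec)) (v : vec) (Om : seq mat) : Prop :=
  [/\ 1%:M \in Om,
      (forall w1 w2, w1 \in Om -> w2 \in Om -> w1 *m w2 \in Om) &
      (forall w, w \in Om -> exists2 w', w' \in Om &
         [/\ w *m w' = 1%:M, w' *m w = 1%:M &
             forall a, a \in rd ->
               (a.1 *m w'^T, a.2 *m w) \in rd /\
               (positive v a -> positive v (a.1 *m w'^T, a.2 *m w))])].

(* extended affine Weyl group  P x| (W_0 x| Omega') , P = Y *)
Definition inWt (rd : datum) (Om : seq mat) (x : elt) : Prop :=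
  exists w0 om, [/\ inW0 rd w0, om \in Om & x.2 = w0 *m om].
Definition inW (rd : datum) (x : elt) : Prop := inQ rd x.1 /\ inW0 rd x.2.

Definition inAlcove (rd : datum) (v : vec) (p : 'rV[rat]_n) : Prop :=
  forall a, a \in rd -> positive v a -> 0 < pairQ a.1 p < 1.

Definition separates (rd : datum) (v : vec) (x : elt) (a : vec * vec) (k : int) : Prop :=
  forall p, inAlcove rd v p ->
    (pairQ a.1 p - intr k) * (pairQ a.1 (act x p) - intr k) < 0.
Definition separatesb (rd : datum) (v : vec) x a k : bool :=
  if excluded_middle_informative (separates rd v x a k) then true else false.

(* all k with |k| <= |<alpha,lambda>| + 1 ; every separating H_{alpha,k}
   (x in the extended affine Weyl group) has k in this range *)
Definition krange (B : nat) : seq int := [seq (i%:Z - B%:Z) | i <- iota 0 (2 * B).+1].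

Definition ell (rd : datum) (v : vec) (x : elt) : nat :=
  (\sum_(a <- rd | positive v a)
     count (separatesb rd v x a) (krange (`|pairing a.1 x.1|%N + 1)))%N.

(* affine reflection s_{alpha,k} : y |-> y - (<alpha,y> - k) alpha^vee *)
Definition aff_refl (a : vec * vec) (k : int) : elt := (k *: a.2, sref a).

(* affine simple reflections S: reflections in the walls of A *)
Definition inS (rd : datum) (v : vec) (s : elt) : Prop :=
  exists a k, [/\ a \in rd, positive v a, s = aff_refl a k & ell rd v s = 1%N].

Definition step (rd : datum) (v : vec) (s x x' : elt) : Prop :=
  [/\ inS rd v s, x' = mul (mul s x) s & (ell rd v x' <= ell rd v x)%N].

Inductive reach (rd : datum) (v : vec) : elt -> elt -> Prop :=
| reach_refl x : reach rd v x x
| reach_step s x y z : step rd v s x y -> reach rd v y z -> reach rd v x z.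

Definition approx (rd : datum) (v : vec) (x x' : elt) : Prop := reach rd v x x' /\ reach rd v x' x.

Definition inClass (rd : datum) (x0 x : elt) : Prop :=
  exists y, inW rd y /\ x = mul (mul y x0) (inv y).

Definition inOmin (rd : datum) (v : vec) (x0 x : elt) : Prop :=
  inClass rd x0 x /\ forall y, inClass rd x0 y -> (ell rd v x <= ell rd v y)%N.

Definition straight (rd : datum) (v : vec) (x : elt) : Prop :=
  forall m, ell rd v (pow x m) = (m * ell rd v x)%N.

Definition straight_class (rd : datum) (v : vec) (x0 : elt) : Prop :=
  exists x, inClass rd x0 x /\ straight rd v x.

End AffineWeyl.

(* Main.v *)
(* Put w = x and let C run over the alcoves yA with y in W, so that
   ell (y^-1 w y) is the number d(C, wC) of hyperplanes separating C and wC.  Some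
   power w^m acts on the roots as the translation by mu, hence
   m d(C, wC) >= d(C, w^m C) = sum_(alpha > 0) |<alpha, mu>|; the class is straight
   exactly when equality is attained, and then the minimal alcoves C ("good" ones)
   are those which w never moves backwards across a hyperplane of a root with
   <alpha, mu> >= 0.
   Let D be the alcove for the root subsystem mu^perp containing a good alcove C;
   it is stable under w.  If C' is another good alcove, simple transitivity of the
   affine Weyl group of mu^perp gives an element z carrying D' to D, and
   uniqueness forces z w = w z; so one may assume that C and C' lie in D.
   From a point q of a good alcove, move along the segment to (q + w q) / 2: all
   alcoves on a minimal gallery from C to wC are good.  Iterating, the displacement
   <alpha, w q - q> is averaged over its (periodic) w-orbit and thus becomes
   positive for all alpha with <alpha, mu> > 0 simultaneously.  The points of D with
   this last property form a convex open set met by good alcoves only, so any two of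
   them are joined by a gallery of good alcoves.  Each wall crossing in this
   gallery is a length-preserving conjugation by a simple reflection. *)
From Stdlib Require ClassicalEpsilon.
From mathcomp Require Import all_boot all_order all_algebra.
From mathcomp Require Import zify ring lra.
Require Import Defs.
Set Implicit Arguments. Unset Strict Implicit. Unset Printing Implicit Defensive.
Import Order.TTheory GRing.Theory Num.Theory.
Local Open Scope ring_scope.

(** * The action on the apartment *)

Section AffineAction.
Variable n : nat.
Notation root := ('rV[int]_n * 'rV[int]_n)%type.
Notation point := 'rV[rat]_n.
Implicit Types (a b : root) (g h : elt n) (p q : point) (w : 'M[int]_n) (x y : 'rV[int]_n).

Lemma mulA g h k : mul g (mul h k) = mul (mul g h) k.
Proof. by rewrite /mul /= mulmxDl !mulmxA addrA. Qed.

Lemma mul1g g : mul (one n) g = g.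
Proof. by case: g => l w; rewrite /mul /one /= !mulmx1 addr0. Qed.

Lemma mulg1 g : mul g (one n) = g.
Proof. by case: g => l w; rewrite /mul /one /= mul0mx mul1mx add0r. Qed.

Lemma mulVg g : g.2 \in unitmx -> mul (inv g) g = one n.
Proof. by move=> gu; rewrite /mul /inv /one /= addrN mulmxV. Qed.

Lemma mulgV g : g.2 \in unitmx -> mul g (inv g) = one n.
Proof. by move=> gu; rewrite /mul /inv /one /= mulNmx mulmxKV // addNr mulVmx. Qed.

Lemma mulKg g h : g.2 \in unitmx -> mul (inv g) (mul g h) = h.
Proof. by move=> gu; rewrite mulA mulVg // mul1g. Qed.

Lemma mulKVg g h : g.2 \in unitmx -> mul g (mul (inv g) h) = h.
Proof. by move=> gu; rewrite mulA mulgV // mul1g. Qed.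

Lemma mulgK g h : g.2 \in unitmx -> mul (mul h g) (inv g) = h.
Proof. by move=> gu; rewrite -mulA mulgV // mulg1. Qed.

Lemma mulgKV g h : g.2 \in unitmx -> mul (mul h (inv g)) g = h.
Proof. by move=> gu; rewrite -mulA mulVg // mulg1. Qed.

Lemma unitmx_mulg g h : g.2 \in unitmx -> h.2 \in unitmx -> (mul g h).2 \in unitmx.
Proof. by move=> gu hu; rewrite /= unitmx_mul hu gu. Qed.

Lemma unitmx_invg g : g.2 \in unitmx -> (inv g).2 \in unitmx.
Proof. by move=> gu; rewrite /= unitmx_inv. Qed.

Lemma inv_uniq g h : g.2 \in unitmx -> mul g h = one n -> h = inv g.
Proof. by move=> gu gh; rewrite -[h](mulKg _ gu) gh mulg1. Qed.

Lemma invg_mul g h : g.2 \in unitmx -> h.2 \in unitmx ->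
  inv (mul g h) = mul (inv h) (inv g).
Proof.
move=> gu hu; apply/esym/inv_uniq; first exact: unitmx_mulg.
by rewrite mulA -(mulA g) mulgV // mulg1 mulgV.
Qed.

Lemma invgK g : g.2 \in unitmx -> inv (inv g) = g.
Proof. by move=> gu; apply/esym/inv_uniq; rewrite ?unitmx_invg ?mulVg. Qed.

Lemma powS g m : pow g m.+1 = mul g (pow g m).
Proof. by []. Qed.

Lemma pow_comm g m : mul g (pow g m) = mul (pow g m) g.
Proof.
elim: m => [|m IH]; first by rewrite /pow /= mulg1 mul1g.
by rewrite !powS -[in RHS]mulA -IH.
Qed.

Lemma map_intrD (A B : 'rV[int]_n) :
  map_mx intr (A + B) = map_mx intr A + map_mx intr B.
Proof. exact: (map_mxD (intmul (1 : rat))). Qed.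

Lemma map_intrM m (A : 'M[int]_(m, n)) w :
  map_mx intr (A *m w) = map_mx intr A *m map_mx intr w.
Proof. exact: (map_mxM (intmul (1 : rat))). Qed.

Lemma actM g h p : act (mul g h) p = act g (act h p).
Proof. by rewrite /act /= mulmxDl map_intrD !map_intrM !mulmxA addrA. Qed.

Lemma act1 p : act (one n) p = p.
Proof.
rewrite /act /one /= (map_mx1 (intmul (1 : rat))) mulmx1.
by rewrite (map_mx0 (intmul (1 : rat))) addr0.
Qed.

Lemma actK g p : g.2 \in unitmx -> act (inv g) (act g p) = p.
Proof. by move=> gu; rewrite -actM mulVg // act1. Qed.

Lemma act_pow g m p : act (pow g m) p = iter m (act g) p.
Proof. by elim: m => [|m IH] /=; rewrite ?act1 // actM IH. Qed.

Lemma act_affine g (t : rat) p q :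
  act g ((1 - t) *: p + t *: q) = (1 - t) *: act g p + t *: act g q.
Proof.
rewrite /act mulmxDl -!scalemxAl !scalerDr addrACA; congr (_ + _).
by rewrite -scalerDl subrK scale1r.
Qed.

(** * The integral pairing, its rational extension, and the action on roots *)

Lemma pairingE x y : pairing x y = (x *m y^T) 0 0.
Proof. by rewrite !mxE; apply: eq_bigr => i _; rewrite !mxE. Qed.

Lemma pairingC x y : pairing x y = pairing y x.
Proof. by apply: eq_bigr => i _; rewrite mulrC. Qed.

Lemma mulmx_trmx x y : x *m y^T = (pairing x y)%:M.
Proof. by rewrite [LHS]mx11_scalar pairingE. Qed.

Lemma pairingDl x x' y : pairing (x + x') y = pairing x y + pairing x' y.
Proof. by rewrite !pairingE mulmxDl !mxE. Qed.

Lemma pairingDr x y y' : pairing x (y + y') = pairing x y + pairing x y'.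
Proof. by rewrite !pairingE linearD mulmxDr !mxE. Qed.

Lemma pairingZl k x y : pairing (k *: x) y = k * pairing x y.
Proof. by rewrite !pairingE -scalemxAl !mxE. Qed.

Lemma pairingZr k x y : pairing x (k *: y) = k * pairing x y.
Proof. by rewrite !pairingE linearZ -scalemxAr !mxE. Qed.

Lemma pairingNl x y : pairing (- x) y = - pairing x y.
Proof. by rewrite -scaleN1r pairingZl mulN1r. Qed.

Lemma pairing_mulr x y w : pairing x (y *m w) = pairing (x *m w^T) y.
Proof. by rewrite !pairingE trmx_mul mulmxA. Qed.

Lemma pairQE x p : pairQ x p = (map_mx intr x *m p^T) 0 0.
Proof. by rewrite !mxE; apply: eq_bigr => i _; rewrite !mxE. Qed.

Lemma pairQD x p q : pairQ x (p + q) = pairQ x p + pairQ x q.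
Proof. by rewrite !pairQE linearD mulmxDr !mxE. Qed.

Lemma pairQZ x (c : rat) p : pairQ x (c *: p) = c * pairQ x p.
Proof. by rewrite !pairQE linearZ -scalemxAr !mxE. Qed.

Lemma pairQB x p q : pairQ x (p - q) = pairQ x p - pairQ x q.
Proof. by rewrite pairQD -scaleN1r pairQZ mulN1r. Qed.

Lemma pairQZl k x p : pairQ (k *: x) p = k%:~R * pairQ x p.
Proof.
rewrite mulr_sumr; apply: eq_bigr => i _.
by rewrite mxE /intr rmorphM mulrA.
Qed.

Lemma pairQDl x x' p : pairQ (x + x') p = pairQ x p + pairQ x' p.
Proof.
rewrite -big_split; apply: eq_bigr => i _.
by rewrite mxE /intr rmorphD mulrDl.
Qed.

Lemma pairQNl x p : pairQ (- x) p = - pairQ x p.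
Proof. by rewrite -scaleN1r pairQZl mulN1r. Qed.

Lemma pairQ_intr x y : pairQ x (map_mx intr y) = (pairing x y)%:~R.
Proof.
rewrite /pairing rmorph_sum; apply: eq_bigr => i _.
by rewrite mxE /intr rmorphM.
Qed.

Lemma pairQ_mulr x p w : pairQ x (p *m map_mx intr w) = pairQ (x *m w^T) p.
Proof. by rewrite !pairQE map_intrM trmx_mul mulmxA map_trmx. Qed.

(** The root pulled back along the linear part: its form is composed with [p |-> p w], and the
    coroot moves by the inverse so that pairings are kept. *)
Definition ract w a : root := (a.1 *m w^T, a.2 *m invmx w).

Lemma pairQ_act a g p :
  pairQ a.1 (act g p) = pairQ (ract g.2 a).1 p + (pairing a.1 g.1)%:~R.
Proof. by rewrite pairQD pairQ_mulr pairQ_intr. Qed.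

Lemma ractM w w' a : w \in unitmx -> w' \in unitmx ->
  ract (w *m w') a = ract w (ract w' a).
Proof.
move=> wu wu'; rewrite /ract /= trmx_mul !mulmxA; congr (_, _).
rewrite -mulmxA; congr (_ *m _).
have wwu : w *m w' \in unitmx by rewrite unitmx_mul wu wu'.
by rewrite -[RHS](mulmxK wwu) mulmxA mulmxKV // mulVmx // mul1mx.
Qed.

Lemma ractK w : w \in unitmx -> cancel (ract w) (ract (invmx w)).
Proof.
move=> wu a; rewrite -ractM ?unitmx_inv // mulVmx // /ract trmx1.
by rewrite invmx1 !mulmx1; case: a.
Qed.

Lemma aff_refl_conj g a k : g.2 \in unitmx ->
  mul (aff_refl a k) g = mul g (aff_refl (ract g.2 a) (k - pairing a.1 g.1)).
Proof.
move=> gu; rewrite /mul /aff_refl /sref /= -scalemxAl mulmxKV //.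
have key : g.1 *m a.1^T *m a.2 = pairing a.1 g.1 *: a.2.
  by rewrite mulmx_trmx mul_scalar_mx pairingC.
congr (_, _).
  by rewrite mulmxBr mulmx1 mulmxA key scalerBl addrC addrA addrAC.
rewrite mulmxBr mulmx1 mulmxA mulmxBl mul1mx trmx_mul trmxK.
by rewrite -!mulmxA mulVmx // mulmx1.
Qed.

End AffineAction.

(** * Floors of roots, distance of points, words in a group *)

Section Alcoves.
Variable n : nat.
Notation root := ('rV[int]_n * 'rV[int]_n)%type.
Notation point := 'rV[rat]_n.
Variable rd : seq root.
Implicit Types (a b : root) (g h : elt n) (p q : point) (w : 'M[int]_n).

(** Stands for membership in the extended affine Weyl group; in this form the property of [x] passes
    to the subsystem [rdmu]. *)
Definition preserves g := g.2 \in unitmx /\ {in rd, forall a, ract g.2 a \in rd}.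
Definition fl a p : int := Num.floor (pairQ a.1 p).
Definition generic p := forall a (k : int), a \in rd -> pairQ a.1 p != k%:~R.
(** Alcoves are represented by generic points. Over a subsystem the same relation describes its
    larger alcoves. *)
Definition same_alcove p q := {in rd, forall a, fl a p = fl a q}.
(** For generic points this is twice the number of separating hyperplanes. Summing over all roots
    makes invariance under root permutations immediate. *)
Definition dist p q : nat := (\sum_(a <- rd) `|(fl a p - fl a q)%R|)%N.
Definition ropp a : root := (- a.1, - a.2).

Lemma fl_act a g p : fl a (act g p) = fl (ract g.2 a) p + pairing a.1 g.1.
Proof. by rewrite /fl pairQ_act floorDrz ?intr_int // intrKfloor. Qed.

Lemma fl_bounds a p : (fl a p)%:~R <= pairQ a.1 p < (fl a p)%:~R + 1.
Proof. by have := floor_itv (pairQ a.1 p); rewrite intrD. Qed.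

Lemma fl_lt a p : generic p -> a \in rd -> (fl a p)%:~R < pairQ a.1 p.
Proof.
move=> gp ard; have /andP[le _] := fl_bounds a p.
by rewrite lt_neqAle le andbT eq_sym gp.
Qed.

Lemma flP a p (k : int) : k%:~R <= pairQ a.1 p < k%:~R + 1 -> fl a p = k.
Proof. by move=> H; apply: floor_def; rewrite intrD. Qed.

Lemma fl_geP a p (k : int) : (k <= fl a p) = (k%:~R <= pairQ a.1 p).
Proof. exact: floor_ge_int. Qed.

Lemma fl_ltP a p (k : int) : (fl a p < k) = (pairQ a.1 p < k%:~R).
Proof. exact: floor_lt_int. Qed.

Lemma generic_act g p : preserves g -> generic p -> generic (act g p).
Proof.
case=> _ gP gp a k ard; rewrite pairQ_act -subr_eq0 -addrA -intrB.
by rewrite -[X in _ + X]opprK subr_eq0 -intrN gp ?gP.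
Qed.

Lemma same_sym p q : same_alcove p q -> same_alcove q p.
Proof. by move=> H a /H. Qed.

Lemma same_trans q p r : same_alcove p q -> same_alcove q r -> same_alcove p r.
Proof. by move=> H1 H2 a ard; rewrite H1 ?H2. Qed.

Lemma same_act g p q : preserves g -> same_alcove p q -> same_alcove (act g p) (act g q).
Proof. by case=> _ gP pq a ard; rewrite !fl_act pq ?gP. Qed.

Lemma dist_triangle q p r : (dist p r <= dist p q + dist q r)%N.
Proof. by rewrite -big_split /=; apply: leq_sum => a _; rewrite leqD_dist. Qed.

Lemma dist_eq0 p q : dist p q = 0%N -> same_alcove p q.
Proof.
move=> H a ard; apply/eqP; rewrite -subr_eq0 -absz_eq0; apply/eqP.
by move: H; rewrite /dist (big_rem _ ard) /=; lia.
Qed.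

Lemma dist_same p p' q q' : same_alcove p p' -> same_alcove q q' -> dist p q = dist p' q'.
Proof. by move=> pp qq; apply: eq_big_seq => a ard; rewrite pp ?qq. Qed.

Hypothesis RD : is_root_datum rd.

Lemma uniq_rd : uniq rd.
Proof. by case: RD => /map_uniq. Qed.

Lemma root_inj a b : a \in rd -> b \in rd -> a.1 = b.1 -> a = b.
Proof.
case: RD => + _ _ _; elim: rd => //= c s IH /andP[cs us].
rewrite !inE => /predU1P[->|ai] /predU1P[->|bi] // e; last exact: IH.
  by case/negP: cs; rewrite e map_f.
by case/negP: cs; rewrite -e map_f.
Qed.

Lemma pairing2 a : a \in rd -> pairing a.1 a.2 = 2.
Proof. by case: RD => _ _ H _ /H. Qed.

Lemma refl_root a b : a \in rd -> b \in rd ->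
  (b.1 - pairing b.1 a.2 *: a.1, b.2 - pairing a.1 b.2 *: a.2) \in rd.
Proof. by case: RD => _ _ _ H ard /(H a b ard). Qed.

Lemma ropp_rd a : a \in rd -> ropp a \in rd.
Proof.
move=> ard; have := refl_root ard ard; rewrite pairing2 // /ropp.
by rewrite !scaler_nat !mulr2n !opprD !addrA !subrr !sub0r.
Qed.

Lemma fl_ropp a p : generic p -> a \in rd -> fl (ropp a) p = - fl a p - 1.
Proof.
move=> gp ard; apply: flP; rewrite /= pairQNl intrB intrN.
have := fl_lt gp ard; have /andP[_] := fl_bounds a p.
by move=> H1 H2; apply/andP; split; lra.
Qed.

Lemma sref_sqr a : a \in rd -> sref a *m sref a = 1%:M.
Proof.
move=> ard; rewrite /sref mulmxBr mulmx1 mulmxBl mul1mx.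
rewrite -mulmxA (mulmxA a.2) mulmx_trmx mul_scalar_mx pairingC pairing2 //.
by rewrite -scalemxAr scaler_nat mulr2n opprB addrK subrK.
Qed.

Lemma sref_unit a : a \in rd -> sref a \in unitmx.
Proof. by move=> ard; have /mulmx1_unit[] := sref_sqr ard. Qed.

Lemma invmx_sref a : a \in rd -> invmx (sref a) = sref a.
Proof.
move=> ard; rewrite -[invmx _]mulmx1 -(sref_sqr ard) mulmxA.
by rewrite mulVmx ?sref_unit // mul1mx.
Qed.

Lemma ract_sref a b : a \in rd -> ract (sref a) b =
  (b.1 - pairing b.1 a.2 *: a.1, b.2 - pairing a.1 b.2 *: a.2).
Proof.
move=> ard; rewrite /ract invmx_sref // /sref; congr (_, _).
  rewrite linearB /= trmx1 trmx_mul trmxK mulmxBr mulmx1 mulmxA.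
  by rewrite mulmx_trmx mul_scalar_mx.
by rewrite mulmxBr mulmx1 mulmxA mulmx_trmx mul_scalar_mx pairingC.
Qed.

Lemma preserves_refl a k : a \in rd -> preserves (aff_refl a k).
Proof.
move=> ard; split=> [|b brd]; first exact: sref_unit.
by rewrite ract_sref // refl_root.
Qed.

Lemma preserves_one : preserves (one n).
Proof.
split=> [|a ard]; first exact: unitmx1.
by rewrite /ract trmx1 invmx1 !mulmx1; case: a ard.
Qed.

Lemma preserves_mul g h : preserves g -> preserves h -> preserves (mul g h).
Proof.
case=> gu gP [hu hP]; split=> [|a ard]; first exact: unitmx_mulg.
by rewrite ractM // hP // gP.
Qed.

Lemma perm_ract g : preserves g -> perm_eq [seq ract g.2 a | a <- rd] rd.
Proof.
case=> gu gP; apply: uniq_perm; rewrite ?uniq_rd //.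
  by rewrite map_inj_uniq ?uniq_rd //; apply: can_inj (ractK gu).
have us : uniq [seq ract g.2 a | a <- rd].
  by rewrite map_inj_uniq ?uniq_rd //; apply: can_inj (ractK gu).
have ss : {subset [seq ract g.2 a | a <- rd] <= rd}.
  by move=> _ /mapP[a ard ->]; apply: gP.
by case: (uniq_min_size us ss); rewrite ?size_map.
Qed.

Lemma preserves_inv g : preserves g -> preserves (inv g).
Proof.
move=> gP; split=> [|a ard]; first by apply: unitmx_invg; case: gP.
move: ard; rewrite -(perm_mem (perm_ract gP)) => /mapP[b brd ->].
by rewrite ractK //; case: gP.
Qed.

Lemma preserves_pow g m : preserves g -> preserves (pow g m).
Proof.
by move=> gP; elim: m => [|m IH]; [apply: preserves_one | apply: preserves_mul].
Qed.

Lemma sum_ract g (F : root -> nat) : preserves g ->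
  (\sum_(a <- rd) F (ract g.2 a) = \sum_(a <- rd) F a)%N.
Proof. by move=> gP; rewrite -[RHS](perm_big _ (perm_ract gP)) big_map. Qed.

Lemma dist_act g p q : preserves g -> dist (act g p) (act g q) = dist p q.
Proof.
move=> gP; rewrite -[RHS](sum_ract _ gP); apply: eq_bigr => a _.
by rewrite !fl_act opprD addrACA subrr addr0.
Qed.

Lemma aff_refl_sqr a k : a \in rd -> mul (aff_refl a k) (aff_refl a k) = one n.
Proof.
move=> ard; rewrite /mul /= sref_sqr //; congr (_, _).
rewrite /sref mulmxBr mulmx1 mulmxA -scalemxAl -scalemxAl.
rewrite mulmx_trmx mul_scalar_mx pairingC pairing2 //.
by rewrite scaler_nat mulr2n scalerDr opprD addrA subrr sub0r addNr.
Qed.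

Lemma inv_aff_refl a k : a \in rd -> inv (aff_refl a k) = aff_refl a k.
Proof.
by move=> ard; apply/esym/inv_uniq; rewrite ?aff_refl_sqr //= sref_unit.
Qed.

Lemma pairQ_refl a k x p : 
  pairQ x (act (aff_refl a k) p) =
  pairQ x p - (pairQ a.1 p - k%:~R) * (pairing x a.2)%:~R.
Proof.
rewrite pairQD pairQ_mulr pairQ_intr pairingZr /= /sref.
rewrite linearB /= trmx1 trmx_mul trmxK mulmxBr mulmx1 mulmxA.
rewrite mulmx_trmx mul_scalar_mx -scaleNr.
rewrite pairQDl pairQZl rmorphN rmorphM /=; ring.
Qed.

Lemma aff_refl_ropp a k : aff_refl (ropp a) (- k) = aff_refl a k.
Proof.
rewrite /aff_refl /sref /= scalerN scaleNr opprK; congr (_, _).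
by rewrite mulmxN [(- a.1)^T]linearN mulNmx opprK.
Qed.

End Alcoves.

(** * Words and the monoid generated by a predicate *)

Section Words.
Variable n : nat.
Implicit Types (P : elt n -> Prop) (g h : elt n) (s : seq (elt n)).

Definition wprod s := foldr (@mul n) (one n) s.
Definition gen P g := exists2 s, (forall h, h \in s -> P h) & g = wprod s.

Lemma wprod_cat s t : wprod (s ++ t) = mul (wprod s) (wprod t).
Proof. by elim: s => [|h s IH] /=; rewrite ?mul1g // IH mulA. Qed.

Lemma gen_one P : gen P (one n).
Proof. by exists [::]. Qed.

Lemma gen_sub P g : P g -> gen P g.
Proof. by exists [:: g] => [h|]; rewrite ?inE /= ?mulg1 // => /eqP->. Qed.

Lemma gen_mul P g h : gen P g -> gen P h -> gen P (mul g h).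
Proof.
case=> s sP -> [t tP ->]; exists (s ++ t); last by rewrite wprod_cat.
by move=> u; rewrite mem_cat => /orP[/sP|/tP].
Qed.

Lemma gen_closed P (C : elt n -> Prop) : C (one n) ->
  (forall g h, C g -> C h -> C (mul g h)) -> (forall g, P g -> C g) ->
  forall g, gen P g -> C g.
Proof.
move=> C1 CM CP g [s sP ->]; elim: s sP => //= h s IH sP.
by apply: CM; [apply/CP/sP/mem_head | apply: IH => u us; apply: sP; rewrite inE us orbT].
Qed.

Lemma gen_trans P Q : (forall g, P g -> gen Q g) -> forall g, gen P g -> gen Q g.
Proof. by apply: gen_closed; [apply: gen_one | apply: gen_mul]. Qed.

Lemma gen_inv P : (forall g, P g -> g.2 \in unitmx /\ P (inv g)) ->
  forall g, gen P g -> gen P (inv g).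
Proof.
move=> PV g gP.
suff [_ //] : g.2 \in unitmx /\ gen P (inv g).
move: g gP; apply: gen_closed => [|g h [gu gi] [hu hi]|g /PV[gu gi]].
- split; first exact: unitmx1.
  suff <- : one n = inv (one n) by apply: gen_one.
  by apply: inv_uniq; rewrite ?mul1g //= unitmx1.
- by split; [apply: unitmx_mulg | rewrite invg_mul //; apply: gen_mul].
- by split=> //; apply: gen_sub.
Qed.

End Words.

(** * Reflections and adjacency of alcoves *)

Section Reflections.
Variable n : nat.
Notation root := ('rV[int]_n * 'rV[int]_n)%type.
Notation point := 'rV[rat]_n.
Variable rd : seq root.
Hypothesis RD : is_root_datum rd.
Implicit Types (a b : root) (g h : elt n) (p q : point).

Definition is_refl g := exists a k, a \in rd /\ g = aff_refl a k.

Lemma gen_refl_preserves g : gen is_refl g -> preserves rd g.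
Proof.
move: g; apply: gen_closed; first exact: preserves_one.
  by move=> g h; apply: preserves_mul.
by move=> _ [a [k [ard ->]]]; apply: preserves_refl.
Qed.

Lemma gen_refl_inv g : gen is_refl g -> gen is_refl (inv g).
Proof.
move: g; apply: gen_inv => _ [a [k [ard ->]]].
by rewrite (inv_aff_refl RD) //; split; [apply: sref_unit ard | exists a, k].
Qed.

Lemma actKrefl a k p : a \in rd -> act (aff_refl a k) (act (aff_refl a k) p) = p.
Proof. by move=> ard; rewrite -actM (aff_refl_sqr RD) ?act1. Qed.

(* Pairing b with its mirror image, the distances to q of p and of its mirror
   image compare by the rearrangement inequality. *)
Lemma dist_refl_lt a k p q : a \in rd -> generic rd p -> generic rd q ->
  fl a p < k <= fl a q -> (dist rd (act (aff_refl a k) p) q < dist rd p q)%N.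
Proof.
move=> ard gp gq /andP[apk kaq].
have sP := preserves_refl RD k ard.
set s := aff_refl a k in sP *.
pose t b := `|(fl b (act s p) - fl b q)%R|%N.
pose u b := `|(fl b p - fl b q)%R|%N.
suff : (\sum_(b <- rd) (t b + t (ract s.2 b)) <
        \sum_(b <- rd) (u b + u (ract s.2 b)))%N.
  rewrite !big_split /= (sum_ract RD t sP) (sum_ract RD u sP).
  by rewrite !addnn ltn_double.
have apk' : pairQ a.1 p < k%:~R by rewrite -fl_ltP.
have kaq' : k%:~R < pairQ a.1 q.
  by rewrite lt_neqAle eq_sym gq // -fl_geP.
have flV b r : fl (ract s.2 b) (act s r) = fl b r - pairing b.1 s.1.
  by rewrite -{2}[r](actKrefl k _ ard) -/s (fl_act b) addrK.
have flE b r : fl (ract s.2 b) r = fl b (act s r) - pairing b.1 s.1.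
  by rewrite fl_act addrK.
have mono b r r' : pairQ b.1 r <= pairQ b.1 r' -> fl b r <= fl b r'.
  exact: le_floor.
have le b : (t b + t (ract s.2 b) <= u b + u (ract s.2 b))%N.
  rewrite /t /u flV !flE.
  have [c0|c0] := leP 0 (pairing b.1 a.2).
    have c0' : 0 <= (pairing b.1 a.2)%:~R :> rat by rewrite ler0z.
    have H1 : fl b p <= fl b (act s p).
      by apply: mono; rewrite pairQ_refl lerDl; nra.
    have H2 : fl b (act s q) <= fl b q.
      by apply: mono; rewrite pairQ_refl gerDl; nra.
    lia.
  have c0' : (pairing b.1 a.2)%:~R < 0 :> rat by rewrite ltrz0.
  have H1 : fl b (act s p) <= fl b p.
    by apply: mono; rewrite pairQ_refl gerDl; nra.
  have H2 : fl b q <= fl b (act s q).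
    by apply: mono; rewrite pairQ_refl lerDl; nra.
  lia.
(* Strictness comes from the term [b = a]: the reflection swaps the sides of level [k], which
   separates [p] from [q]. *)
rewrite !(big_rem a ard) /= -addSn; apply: leq_add; last by apply: leq_sum.
rewrite /t /u flV !flE.
have H1 : k <= fl a (act s p).
  by rewrite fl_geP pairQ_refl (pairing2 RD) //; lra.
have H2 : fl a (act s q) < k.
  by rewrite fl_ltP pairQ_refl (pairing2 RD) //; lra.
lia.
Qed.

Lemma dist_sep p q : generic rd p -> generic rd q -> (0 < dist rd p q)%N ->
  exists2 a, a \in rd & fl a p < fl a q.
Proof.
move=> gp gq d0.
have /hasP[a ard ne] : has (fun a => fl a p != fl a q) rd.
  apply: contraLR d0 => /hasPn H; rewrite -leqNgt leqn0 /dist big1_seq //= => a ard.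
  by apply/eqP; rewrite absz_eq0 subr_eq0; have := H a ard; rewrite negbK.
case: (ltgtP (fl a p) (fl a q)) ne => // [lt|gt] _; first by exists a.
exists (ropp a); first exact: ropp_rd.
by rewrite (fl_ropp gp ard) (fl_ropp gq ard); lia.
Qed.

(** Induction on the distance: reflecting [p] in a hyperplane separating it from [q] brings it
    closer. *)
Lemma refl_transitive p q : generic rd p -> generic rd q ->
  exists2 y, gen is_refl y & same_alcove rd (act y p) q.
Proof.
move: {2}(dist rd p q).+1 (ltnSn (dist rd p q)) => m.
elim: m p => // m IH p dm gp gq.
case: (posnP (dist rd p q)) => [/dist_eq0 H|d0].
  by exists (one n); [apply: gen_one | rewrite act1].
have [a ard lt] := dist_sep gp gq d0.
pose s := aff_refl a (fl a q).
have sP : preserves rd s by apply: preserves_refl.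
have [||y yW yp] := IH (act s p) _ _ gq.
- by rewrite -ltnS; apply: leq_trans dm; apply: dist_refl_lt; rewrite ?lt /=.
- exact: generic_act.
exists (mul y s); last by rewrite actM.
by apply: gen_mul => //; apply: gen_sub; exists a, (fl a q).
Qed.

(** The hyperplane of [(a, k)] is the only one between the two alcoves, and it is crossed upwards
    from [p] to [q]. *)
Definition adj a k p q := [/\ a \in rd, generic rd p, generic rd q,
  fl a p = k - 1 /\ fl a q = k &
  forall b, b \in rd -> b != a -> b != ropp a -> fl b p = fl b q].

Lemma adj_sym a k p q : adj a k p q -> adj (ropp a) (- k) q p.
Proof.
case=> ard gp gq [ap aq] H; split=> //; first exact: ropp_rd.
  by rewrite (fl_ropp gp ard) (fl_ropp gq ard) ap aq; split; lia.
move=> b brd ba boa; rewrite H //.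
by apply: contraNneq boa => ->; rewrite /ropp /= !opprK -surjective_pairing.
Qed.

(** The segment from [p] to [q] meets the wall in a point [r] fixed by the reflection. For roots
    other than [a] and its opposite, [r] has the floors of [p] and [q], so the reflection keeps
    these floors. *)
Lemma adj_same a k p q : adj a k p q -> same_alcove rd (act (aff_refl a k) p) q.
Proof.
case=> ard gp gq [ap aq] H b brd.
pose s := aff_refl a k; rewrite -/s.
have sP : preserves rd s by apply: preserves_refl.
have := fl_lt gp ard; have := fl_lt gq ard.
have := fl_bounds a p; have := fl_bounds a q.
rewrite ap aq rmorphB /= => /andP[aq1 aq2] /andP[ap1 ap2] aq3 ap3.
have reflE r : pairQ a.1 (act s r) = 2 * k%:~R - pairQ a.1 r.
  by rewrite pairQ_refl (pairing2 RD) //; ring.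
have [->|ba] := eqVneq b a; first by rewrite aq; apply: flP; rewrite reflE; lra.
have [->|boa] := eqVneq b (ropp a).
  rewrite (fl_ropp gq ard) (fl_ropp (generic_act sP gp) ard) aq.
  by congr (- _ - _); apply: flP; rewrite reflE; lra.
pose b' := ract s.2 b.
have b'rd : b' \in rd by case: sP => _; apply.
have sa : ract s.2 a = ropp a.
  rewrite (ract_sref RD) // (pairing2 RD) // /ropp.
  by rewrite !scaler_nat !mulr2n !opprD !addrA !subrr !sub0r.
have inj : injective (ract s.2) := can_inj (ractK (sref_unit RD ard)).
have soa : ract s.2 (ropp a) = a.
  by have := ractK (sref_unit RD ard) a; rewrite (invmx_sref RD) // [ract (sref a) a]sa.
have b'a : b' != a by apply: contraNneq boa; rewrite -{1}soa => /inj->.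
have b'oa : b' != ropp a by apply: contraNneq ba; rewrite -sa => /inj->.
rewrite fl_act -/b' -(H b) //.
pose t := (k%:~R - pairQ a.1 p) / (pairQ a.1 q - pairQ a.1 p).
have d0 : 0 < pairQ a.1 q - pairQ a.1 p by lra.
have t0 : 0 < t by rewrite divr_gt0 //; lra.
have t1 : t < 1 by rewrite ltr_pdivrMr // mul1r; lra.
pose r := (1 - t) *: p + t *: q.
have rE c : pairQ c.1 r = (1 - t) * pairQ c.1 p + t * pairQ c.1 q.
  by rewrite pairQD !pairQZ.
have ar : pairQ a.1 r = k%:~R.
  have td : t * (pairQ a.1 q - pairQ a.1 p) = k%:~R - pairQ a.1 p.
    by rewrite divfK ?gt_eqF.
  by rewrite rE; lra.
have flr c : c \in rd -> c != a -> c != ropp a -> fl c r = fl c p.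
  move=> crd ca coa; apply: flP; rewrite rE.
  have := fl_bounds c p; have := fl_bounds c q; rewrite -(H c) //.
  by move=> /andP[? ?] /andP[? ?]; apply/andP; split; nra.
rewrite -(flr b) // -(flr b') // -[RHS]/(fl b r).
rewrite -fl_act /fl pairQ_refl ar subrr mul0r subr0 //.
Qed.

Hypothesis red : reduced rd.

(** Pairing the relation with the coroot of [b] gives [c * pairing a.1 b.2 = 4], so [c] divides 4.
    The values 2 and -2 are the two conclusions; 1, -1, 4 and -4 make one root twice another, which
    reducedness excludes. *)
Lemma root_prop a b : a \in rd -> b \in rd ->
  2 *: b.1 = pairing b.1 a.2 *: a.1 -> b = a \/ b = ropp a.
Proof.
move=> ard brd e; set c := pairing b.1 a.2 in e.
have e4 : 4 = c * pairing a.1 b.2.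
  have := congr1 (fun z => pairing z b.2) e.
  by rewrite !pairingZl (pairing2 RD) // => <-.
have cle : (`|c| <= 4)%N.
  by apply: dvdn_leq => //; apply/dvdnP; exists `|pairing a.1 b.2|%N; lia.
have neq x : x \in rd -> forall y, y \in rd -> x.1 = 2 *: y.1 -> False.
  move=> xrd y yrd xy; have := red yrd; rewrite -xy map_f //.
have half (x y : 'rV[int]_n) : 2 *: x = 2 *: y -> x = y.
  move/rowP=> H; apply/rowP => i; apply: (@mulfI int 2) => //.
  by have := H i; rewrite !mxE.
have oa := ropp_rd RD ard.
have : c = 2 \/ c = -2 \/ c = 1 \/ c = -1 \/ c = 4 \/ c = - 4 \/ (`|c| = 3)%N \/ c = 0.
  by lia.
case=> [c2|[c2|[c1|[c1|[c4|[c4|[c3|c0]]]]]]].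
- by left; apply: (root_inj RD) => //; apply: half; rewrite e c2.
- right; apply: (root_inj RD) => //; apply: half.
  by rewrite e c2 /= scalerN scaleNr.
- by case: (neq a ard b brd); rewrite e c1 scale1r.
- by case: (neq _ oa b brd); rewrite e c1 scaleN1r.
- case: (neq b brd a ard); apply: half.
  by rewrite e c4 scalerA.
- case: (neq b brd _ oa); apply: half.
  by rewrite e c4 scalerA /= scalerN scaleNr.
- by lia.
- by lia.
Qed.

End Reflections.

(** * The length function as a distance *)

Section Length.
Variable n : nat.
Notation root := ('rV[int]_n * 'rV[int]_n)%type.
Notation point := 'rV[rat]_n.
Variables (rd : seq root) (v : 'rV[int]_n).
Hypotheses (RD : is_root_datum rd) (Rv : regular rd v).
Implicit Types (a b : root) (g h : elt n) (p q : point).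

(** Divide [v] by a number exceeding all its pairings with roots. *)
Lemma exists_alcove : exists p, inAlcove rd v p.
Proof.
pose N := (\sum_(a <- rd) `|pairing a.1 v|)%N.+1.
exists ((N%:R)^-1 *: map_mx intr v) => a ard apos.
have N0 : 0 < N%:R :> rat by rewrite ltr0n.
rewrite pairQZ pairQ_intr mulrC divr_gt0 ?ltr0z //=.
rewrite ltr_pdivrMr // mul1r -[N%:R]/(N%:Z%:~R) ltr_int.
by move: apos; rewrite /positive /N (big_rem a ard) /=; lia.
Qed.

Lemma positive_ropp a : a \in rd -> positive v (ropp a) = ~~ positive v a.
Proof. by move=> /Rv /negPf ne; rewrite /positive pairingNl oppr_gt0 -leNgt le_eqVlt ne. Qed.

Lemma alcove_neg p a : inAlcove rd v p -> a \in rd -> ~~ positive v a ->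
  -1 < pairQ a.1 p < 0.
Proof.
move=> pA ard na; have := pA (ropp a) (ropp_rd RD ard).
by rewrite positive_ropp // na pairQNl => /(_ isT) /andP[H1 H2]; apply/andP; split; lra.
Qed.

Lemma alcove_fl p a : inAlcove rd v p -> a \in rd ->
  fl a p = if positive v a then 0 else -1.
Proof.
move=> pA ard; apply: flP; have := alcove_neg pA ard; have := pA a ard.
case: positive => [/(_ isT) /andP[H1 H2] _|_ /(_ isT) /andP[H1 H2]];
  apply/andP; split; lra.
Qed.

Lemma alcove_generic p : inAlcove rd v p -> generic rd p.
Proof.
move=> pA a k ard; apply/eqP => e.
have := alcove_neg pA ard; have := pA a ard.
case: positive => [/(_ isT) H _|_ /(_ isT) H]; move: H; rewrite e.
  by rewrite ltr0z -[1]/(1%:~R) ltr_int; lia.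
by rewrite ltrz0 -[-1]/((-1)%:~R) ltr_int; lia.
Qed.

Lemma alcove_same p q : inAlcove rd v p -> inAlcove rd v q -> same_alcove rd p q.
Proof. by move=> pA qA a ard; rewrite !alcove_fl. Qed.

(** The floor of [a] is constant on the image alcove, so separation can be tested at one point: the
    levels in question lie between the interval [(0, 1)] and that floor. *)
Lemma separatesE x a k p : preserves rd x -> inAlcove rd v p -> a \in rd ->
  positive v a ->
  separatesb rd v x a k = (0 < k <= fl a (act x p)) || (fl a (act x p) < k <= 0).
Proof.
move=> xP pA ard apos.
have flE q : inAlcove rd v q -> fl a (act x q) = fl a (act x p).
  by move=> qA; apply: same_act ard; last exact: alcove_same.
have xgen q : inAlcove rd v q -> pairQ a.1 (act x q) != k%:~R.
  by move=> qA; apply: generic_act ard; last exact: alcove_generic.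
set f := fl a (act x p).
rewrite /separatesb; case: ClassicalEpsilon.excluded_middle_informative => [H|H].
  have := H p pA; have /andP[a0 a1] := pA a ard apos; rewrite /intr -/f => s0.
  apply/esym; have [k0|k0] := leP k 0.
    have k0' : k%:~R <= 0 :> rat by rewrite lerz0.
    by rewrite /= andbT /f fl_ltP; nra.
  have k0' : 1 <= k%:~R :> rat by rewrite -[1]/(1%:~R) ler_int; lia.
  by rewrite /= andbF orbF /f fl_geP; nra.
apply/esym/negP => K; apply: H => q qA; rewrite /intr.
have /andP[a0 a1] := pA a ard apos; have /andP[b0 b1] := qA a ard apos.
have := xgen q qA; case/orP: K => /andP[k1 k2] ne.
  have k1' : 1 <= k%:~R :> rat by rewrite -[1]/(1%:~R) ler_int; lia.
  have : k%:~R < pairQ a.1 (act x q).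
    by rewrite lt_neqAle eq_sym ne -fl_geP flE.
  by nra.
have k2' : k%:~R <= 0 :> rat by rewrite lerz0.
have : pairQ a.1 (act x q) < k%:~R by rewrite -fl_ltP flE.
by nra.
Qed.

Lemma count_itv (m m' N : nat) :
  count (fun i => (m <= i < m')%N) (iota 0 N) = (minn m' N - minn m N)%N.
Proof.
elim: N => [|N IH]; first by rewrite !minn0.
by rewrite -addn1 iotaD count_cat IH /=; case: ltnP => ? /=; case: ltnP => ?; lia.
Qed.

Lemma count_krange (f : int) (B : nat) : (`|f| <= B)%N ->
  count (fun k : int => (0 < k <= f) || (f < k <= 0)) (krange B) = `|f|%N.
Proof.
move=> fB; rewrite count_map.
have [f0|f0] := leP 0 f.
  (* In [krange] the level [k] has index [k + B], so [k = 1] has index [B.+1]. *)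
  rewrite (@eq_count _ _ (fun i => B.+1 <= i < B.+1 + `|f|)%N).
    by rewrite count_itv; lia.
  by move=> i /=; lia.
rewrite (@eq_count _ _ (fun i => B.+1 - `|f| <= i < B.+1)%N).
  by rewrite count_itv; lia.
by move=> i /=; lia.
Qed.

Lemma perm_ropp : perm_eq [seq ropp a | a <- rd] rd.
Proof.
have inj : injective (@ropp n).
  by move=> [a1 a2] [b1 b2] [/oppr_inj-> /oppr_inj->].
have us : uniq [seq ropp a | a <- rd] by rewrite map_inj_uniq ?(uniq_rd RD).
have ss : {subset [seq ropp a | a <- rd] <= rd}.
  by move=> _ /mapP[a ard ->]; apply: ropp_rd.
apply: uniq_perm; rewrite ?(uniq_rd RD) //.
by case: (uniq_min_size us ss); rewrite ?size_map.
Qed.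

(* Each separating hyperplane is counted by both of its roots. *)
Lemma ell_dist x p : preserves rd x -> inAlcove rd v p ->
  dist rd p (act x p) = (2 * ell rd v x)%N.
Proof.
move=> xP pA.
have -> : ell rd v x = (\sum_(a <- rd | positive v a) `|(fl a p - fl a (act x p))%R|)%N.
  rewrite /ell big_seq_cond [RHS]big_seq_cond.
  apply: eq_bigr => a /andP[ard apos].
  rewrite (eq_count (fun k => separatesE k xP pA ard apos)) count_krange.
    by rewrite (alcove_fl pA ard) apos sub0r abszN.
  (* The floor on the base alcove is 0 or -1, so the margin 1 in the bound of [krange] covers the
     floor on the image. *)
  case: xP => _ /(_ a ard) xrd; rewrite fl_act (alcove_fl pA xrd).
  by case: ifP => _; lia.
rewrite /dist (bigID (positive v)) /= mul2n -addnn; congr (_ + _)%N.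
rewrite -[LHS](perm_big _ perm_ropp) big_map big_seq_cond [RHS]big_seq_cond.
apply: eq_big => [a|a /andP[ard _]].
  by case ard: (a \in rd); rewrite //= positive_ropp // negbK.
have gp := alcove_generic pA.
by rewrite (fl_ropp gp ard) (fl_ropp (generic_act xP gp) ard); lia.
Qed.

End Length.

(** * Galleries in convex open sets *)

(** [P] holds for all sufficiently small positive [e]. Closure under finite conjunctions lets one
    perturbation meet finitely many demands. *)
Definition small_enough (P : rat -> Prop) :=
  exists2 e0, 0 < e0 & forall e, 0 < e <= e0 -> P e.

Lemma small_enough_ex P : small_enough P -> exists2 e, 0 < e & P e.
Proof. by case=> e e0 H; exists e => //; apply: H; rewrite e0 lexx. Qed.

Lemma small_enough_imp (P Q : rat -> Prop) : (forall e, 0 < e -> P e -> Q e) ->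
  small_enough P -> small_enough Q.
Proof.
move=> PQ [e0 e0P H]; exists e0 => // e /andP[e1 e2].
by apply: PQ => //; apply: H; rewrite e1.
Qed.

Lemma small_enough_and P Q : small_enough P -> small_enough Q ->
  small_enough (fun e => P e /\ Q e).
Proof.
move=> [e1 p1 H1] [e2 p2 H2]; exists (Num.min e1 e2).
  by rewrite lt_min p1.
by move=> e; rewrite le_min => /and3P[e0 ? ?]; split; [apply: H1|apply: H2]; apply/andP.
Qed.

Lemma small_enough_all (T : eqType) (s : seq T) (P : T -> rat -> Prop) :
  {in s, forall x, small_enough (P x)} ->
  small_enough (fun e => {in s, forall x, P x e}).
Proof.
elim: s => [|x s IH] H; first by exists 1.
have H1 : small_enough (P x) by apply: H; rewrite mem_head.
have {}IH : small_enough (fun e => {in s, forall x, P x e}).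
  by apply: IH => y ys; apply: H; rewrite inE ys orbT.
apply: small_enough_imp (small_enough_and H1 IH) => e _ [Px Ps] y.
by rewrite inE => /predU1P[->|/Ps].
Qed.

Lemma small_enough_gt0 (c d : rat) : 0 < c -> small_enough (fun e => 0 < c + e * d).
Proof.
move=> c0; exists (c / (1 + `|d|) / 2).
  by rewrite divr_gt0 // divr_gt0 // ltr_pwDl.
move=> e /andP[e0 ele].
have d1 : 0 < 1 + `|d| by rewrite ltr_pwDl.
have : e * 2 * (1 + `|d|) <= c by rewrite -ler_pdivlMr // -ler_pdivlMr.
have : - d <= `|d| by rewrite -normrN ler_norm.
by nra.
Qed.

Lemma small_enough_lt (c d c' d' : rat) : c < c' ->
  small_enough (fun e => c + e * d < c' + e * d').
Proof.
rewrite -subr_gt0 => /(small_enough_gt0 (d' - d)).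
by apply: small_enough_imp => e _; nra.
Qed.

Lemma small_enough_neq0 (c d : rat) : c != 0 \/ d != 0 ->
  small_enough (fun e => c + e * d != 0).
Proof.
have [->|c0 _] := eqVneq c 0.
  case=> // d0; exists 1 => // e /andP[e0 _].
  by rewrite add0r mulf_neq0 // gt_eqF.
case: (ltgtP c 0) c0 => // c0 _.
  have := small_enough_lt d 0 c0; apply: small_enough_imp => e _.
  by rewrite mulr0 addr0 => /lt_eqF->.
by have := small_enough_gt0 d c0; apply: small_enough_imp => e _ /gt_eqF->.
Qed.

(** For small [e] the value stays strictly between two consecutive integers, around the floor [m] of
    [c]; if [c = m] the interval is above or below [m] according to the sign of [d]. *)
Lemma small_enough_nonint (c d : rat) :
  (forall k : int, c != k%:~R) \/ d != 0 ->
  small_enough (fun e => forall k : int, c + e * d != k%:~R).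
Proof.
have strict (m : int) : small_enough (fun e => m%:~R < c + e * d < m%:~R + 1) ->
    small_enough (fun e => forall k : int, c + e * d != k%:~R).
  apply: small_enough_imp => e _ /andP[H1 H2] k; apply/eqP => E.
  move: H1 H2; rewrite E ltr_int -[_ + 1]/(_ + 1%:~R) -intrD ltr_int; lia.
have := floor_itv c; rewrite intrD; set m := Num.floor c => /andP[le1 lt1] H.
have up : small_enough (fun e => c + e * d < m%:~R + 1).
  have := small_enough_lt d 0 lt1; apply: small_enough_imp => e _.
  by rewrite mulr0 addr0.
move: le1; rewrite le_eqVlt => /orP[/eqP cm|lt0].
  have {}H : d != 0 by case: H => // /(_ m); rewrite cm eqxx.
  case: (ltgtP d 0) H => // d0 _.
    apply: (strict (m - 1)); rewrite intrB subrK -cm.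
    have : m%:~R - 1 < m%:~R :> rat by lra.
    move=> /(small_enough_lt 0 d); apply: small_enough_imp => e e0.
    by move=> h; apply/andP; split; nra.
  apply: (strict m); apply: small_enough_imp up => e e0 h.
  by rewrite h cm ltrDl andbT mulr_gt0.
apply: (strict m).
have := small_enough_and up (small_enough_lt 0 d lt0).
by apply: small_enough_imp => e _ []; rewrite mulr0 addr0 => -> ->.
Qed.

Lemma conv_ge (t x y z : rat) : 0 <= t <= 1 -> z <= x -> z <= y ->
  z <= (1 - t) * x + t * y.
Proof.
move=> /andP[t0 t1] zx zy.
have : 0 <= (1 - t) * (x - z) by rewrite mulr_ge0 // subr_ge0.
have : 0 <= t * (y - z) by rewrite mulr_ge0 // subr_ge0.
lra.
Qed.

Lemma conv_gt (t x y z : rat) : 0 <= t <= 1 -> z < x -> z < y ->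
  z < (1 - t) * x + t * y.
Proof.
move=> t01 zx zy; have zm : z < Num.min x y by rewrite lt_min zx.
by apply: (lt_le_trans zm); apply: conv_ge; rewrite // ge_min lexx ?orbT.
Qed.

Lemma conv_lt (t x y z : rat) : 0 <= t <= 1 -> x < z -> y < z ->
  (1 - t) * x + t * y < z.
Proof.
move=> t01 zx zy; rewrite -ltrN2 opprD -!mulrN.
by apply: conv_gt; rewrite ?ltrN2.
Qed.

Section Galleries.
Variable n : nat.
Notation root := ('rV[int]_n * 'rV[int]_n)%type.
Notation point := 'rV[rat]_n.
Implicit Types (a b : root) (p q r u : point) (U : point -> Prop).

(** A rational vector space is not a finite union of hyperplanes. The vector found for the tail is
    perturbed along a coordinate where [f] does not vanish. *)
Lemma avoid_hyperplanes (fs : seq point) : {in fs, forall f, f != 0} ->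
  exists u, {in fs, forall f, (f *m u^T) 0 0 != 0}.
Proof.
elim: fs => [|f fs IH] H; first by exists 0.
have [|u uP] := IH; first by move=> g gs; apply: H; rewrite inE gs orbT.
have /eqP/rowP f0 : f != 0 by apply: H; rewrite mem_head.
have [i fi] : exists i, f 0 i != 0.
  apply/existsP; rewrite -negb_forall; apply: contra_notN f0 => /forallP f0 i.
  by rewrite mxE; apply/eqP.
pose d : point := delta_mx 0 i.
have E g e : (g *m (u + e *: d)^T) 0 0 = (g *m u^T) 0 0 + e * g 0 i.
  rewrite linearD linearZ mulmxDr -scalemxAr !mxE; congr (_ + _ * _).
  rewrite (bigD1 i) //= !mxE !eqxx mulr1 big1 ?addr0 // => j ji.
  by rewrite !mxE (negPf ji) andbF mulr0.
suff /small_enough_ex[e _ He] :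
    small_enough (fun e => {in f :: fs, forall g, (g *m (u + e *: d)^T) 0 0 != 0}).
  by exists (u + e *: d).
apply: small_enough_all => g; rewrite inE => gs.
have : (g *m u^T) 0 0 != 0 \/ g 0 i != 0.
  by case/predU1P: gs => [->|/uP]; [right|left].
by move=> /small_enough_neq0; apply: small_enough_imp => e _; rewrite E.
Qed.

Variable rd : seq root.

Lemma small_enough_generic p u :
  {in rd, forall a, (forall k : int, pairQ a.1 p != k%:~R) \/ pairQ a.1 u != 0} ->
  small_enough (fun e => generic rd (p + e *: u)).
Proof.
move=> H; suff : small_enough (fun e => {in rd, forall a,
    forall k : int, pairQ a.1 p + e * pairQ a.1 u != k%:~R}).
  by apply: small_enough_imp => e _ K a k ard; rewrite pairQD pairQZ K.
by apply: small_enough_all => a /H /small_enough_nonint.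
Qed.

Lemma small_enough_fl a p u : (forall k : int, pairQ a.1 p != k%:~R) ->
  small_enough (fun e => fl a p = fl a (p + e *: u)).
Proof.
move=> ap; have /andP[le0 lt1] := fl_bounds a p.
have lt0 : (fl a p)%:~R < pairQ a.1 p by rewrite lt_neqAle eq_sym ap.
have := small_enough_and (small_enough_lt 0 (pairQ a.1 u) lt0)
  (small_enough_lt (pairQ a.1 u) 0 lt1).
apply: small_enough_imp => e _; rewrite !mulr0 !addr0 => -[h1 h2].
by apply/esym/flP; rewrite pairQD pairQZ h2 ltW.
Qed.

Lemma small_enough_same p u : generic rd p ->
  small_enough (fun e => same_alcove rd p (p + e *: u)).
Proof.
by move=> gp; apply: small_enough_all => a ard; apply: small_enough_fl => k; apply: gp.
Qed.

Definition convex U := forall p q t, 0 <= t <= 1 -> U p -> U q ->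
  U ((1 - t) *: p + t *: q).
(** Algebraic openness: each point can be moved a little in every direction. *)
Definition opened U := forall p u, U p -> small_enough (fun e => U (p + e *: u)).

(** [U] is required of the chosen points only, not of whole alcoves; [gallery_same] changes the
    representative. *)
Inductive gallery U : point -> point -> Prop :=
| gallery_same p q : U p -> U q -> generic rd p -> generic rd q -> same_alcove rd p q ->
    gallery U p q
| gallery_adj a k p q : U p -> U q -> adj rd a k p q -> gallery U p q
| gallery_trans q p r : gallery U p q -> gallery U q r -> gallery U p r.

Lemma gallery_sub U U' p q : (forall r, generic rd r -> U r -> U' r) ->
  gallery U p q -> gallery U' p q.
Proof.
move=> UU; elim=> {p q} [p q up uq gp gq pq|a k p q up uq pq|q p r _ IH1 _ IH2].
- by apply: gallery_same => //; apply: UU.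
- by case: (pq) => _ gp gq _ _; apply: gallery_adj pq; apply: UU.
- exact: gallery_trans IH1 IH2.
Qed.

Lemma dist_between q p r :
  {in rd, forall a, (fl a p <= fl a q <= fl a r) || (fl a r <= fl a q <= fl a p)} ->
  dist rd p r = (dist rd p q + dist rd q r)%N.
Proof.
by move=> H; rewrite -big_split /=; apply: eq_big_seq => a /H; lia.
Qed.

Lemma dist_gt0 a p q : a \in rd -> fl a p != fl a q -> (0 < dist rd p q)%N.
Proof.
by move=> ard ne; case: posnP => // /dist_eq0 /(_ a ard) e; rewrite e eqxx in ne.
Qed.

Hypotheses (RD : is_root_datum rd) (red : reduced rd).

(** The segment crosses hyperplanes of different directions at different times. *)
Definition transverse p q := forall t a b (k j : int),
  0 <= t <= 1 -> a \in rd -> b \in rd ->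
  (1 - t) * pairQ a.1 p + t * pairQ a.1 q = k%:~R ->
  (1 - t) * pairQ b.1 p + t * pairQ b.1 q = j%:~R -> b = a \/ b = ropp a.

Lemma crossing a (k : int) p q : fl a p < k <= fl a q ->
  exists2 t, 0 < t <= 1 & (1 - t) * pairQ a.1 p + t * pairQ a.1 q = k%:~R.
Proof.
rewrite fl_ltP fl_geP => /andP[lt le].
have d0 : 0 < pairQ a.1 q - pairQ a.1 p by lra.
exists ((k%:~R - pairQ a.1 p) / (pairQ a.1 q - pairQ a.1 p)).
  apply/andP; split; first by rewrite divr_gt0 // subr_gt0.
  by rewrite ler_pdivrMr // mul1r; lra.
rewrite mulrBl mul1r addrAC -addrA -mulrBr divfK ?gt_eqF //; lra.
Qed.

(** Limits the levels met by the segment to a finite range, so that transversality amounts to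
    finitely many conditions. *)
Lemma crossing_bound a (i : int) t p q : 0 <= t <= 1 ->
  (1 - t) * pairQ a.1 p + t * pairQ a.1 q = i%:~R ->
  (`|i| <= (`|fl a p| + `|fl a q|).+1)%N.
Proof.
move=> t01 E; have /andP[x1 x2] := fl_bounds a p; have /andP[y1 y2] := fl_bounds a q.
move: x1 x2 y1 y2; set x := fl a p; set y := fl a q => x1 x2 y1 y2.
have i1 : Num.min x y <= i.
  rewrite -(ler_int rat) -E; apply: conv_ge => //.
    by apply: le_trans x1; rewrite ler_int ge_min lexx.
  by apply: le_trans y1; rewrite ler_int ge_min lexx orbT.
have i2 : i < Num.max x y + 1.
  rewrite -(ltr_int rat) intrD -E; apply: conv_lt => //.
    by apply: (lt_le_trans x2); rewrite lerD2r ler_int le_max lexx.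
  by apply: (lt_le_trans y2); rewrite lerD2r ler_int le_max lexx orbT.
by move: i1 i2; clearbody x y; clear; lia.
Qed.

Lemma mem_krange (i : int) (B : nat) : (`|i| <= B)%N -> i \in krange B.
Proof.
by move=> iB; apply/mapP; exists `|(i + B%:Z)%R|%N; rewrite ?mem_iota; lia.
Qed.

(** Induction on the distance. If two hyperplanes are crossed at different times, cut the segment
    between them; both pieces are shorter and inherit transversality. Otherwise a single hyperplane
    is crossed. *)
Lemma gallery_line U p q : convex U -> U p -> U q -> generic rd p -> generic rd q ->
  transverse p q -> gallery U p q.
Proof.
move=> cU; move: {2}(dist rd p q).+1 (ltnSn (dist rd p q)) => m.
elim: m p q => // m IH p q dm up uq gp gq tr.
case: (posnP (dist rd p q)) => [/dist_eq0|d0]; first exact: gallery_same.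
have split a b (k j : int) t1 t2 : fl a p < k <= fl a q -> fl b p < j <= fl b q ->
    a \in rd -> b \in rd -> 0 < t1 <= 1 -> 0 < t2 <= 1 -> t1 < t2 ->
    (1 - t1) * pairQ a.1 p + t1 * pairQ a.1 q = k%:~R ->
    (1 - t2) * pairQ b.1 p + t2 * pairQ b.1 q = j%:~R -> gallery U p q.
  move=> ka jb ard brd /andP[t10 t11] /andP[t20 t21] t12 e1 e2.
  have gen0 : small_enough (fun e => generic rd ((p + t1 *: (q - p)) + e *: (q - p))).
    apply: small_enough_generic => c crd.
    have [z|nz] := eqVneq (pairQ c.1 (q - p)) 0; last by right.
    by left=> i; rewrite pairQD pairQZ z mulr0 addr0 gp.
  have /small_enough_ex[e e0 [gr]] :=
    small_enough_and gen0 (small_enough_lt 1 0 t12).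
  rewrite mulr1 mulr0 addr0 => lt.
  (* Cut just after [t1] and before [t2], at a generic point. *)
  pose t := t1 + e; pose r := (1 - t) *: p + t *: q.
  have rE c : pairQ c.1 r = (1 - t) * pairQ c.1 p + t * pairQ c.1 q.
    by rewrite pairQD !pairQZ.
  have {}gr : generic rd r.
    move=> c i crd; have := gr c i crd; rewrite !pairQD !pairQZ pairQB.
    by congr (_ != _); rewrite /t; ring.
  have t01 : 0 <= t <= 1 by rewrite /t; apply/andP; split; lra.
  have ur : U r by apply: cU.
  have btw : dist rd p q = (dist rd p r + dist rd r q)%N.
    apply: dist_between => c _.
    have [le|/ltW le] := leP (pairQ c.1 p) (pairQ c.1 q); apply/orP; [left|right];
      by apply/andP; split; apply: le_floor; rewrite rE; nra.
  have d1 : (0 < dist rd p r)%N.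
    have : fl a p < fl a r.
      case/andP: ka => ka1 ka2; apply: (lt_le_trans ka1).
      rewrite fl_geP rE; move: ka1 ka2; rewrite fl_ltP fl_geP /t; nra.
    by move/lt_eqF/negbT; apply: dist_gt0.
  have d2 : (0 < dist rd r q)%N.
    have : fl b r < fl b q.
      case/andP: jb => ka1 ka2; apply: lt_le_trans ka2.
      rewrite fl_ltP rE; move: ka1; rewrite fl_ltP /t; nra.
    by move/lt_eqF/negbT; apply: dist_gt0.
  have l1 : (dist rd p r < m)%N.
    by rewrite -ltnS; apply: leq_trans dm; rewrite ltnS btw -addn1 leq_add2l.
  have l2 : (dist rd r q < m)%N.
    by rewrite -ltnS; apply: leq_trans dm; rewrite ltnS btw -add1n leq_add2r.
  apply: (@gallery_trans _ r); apply: IH => //.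
    move=> s c d i j' /andP[s0 s1] crd drd; rewrite !rE => E1 E2.
    apply: (tr (s * t) c d i j') => //.
    - by case/andP: t01 => ? ?; apply/andP; split; nra.
    - by rewrite -E1; ring.
    - by rewrite -E2; ring.
  move=> s c d i j' /andP[s0 s1] crd drd; rewrite !rE => E1 E2.
  apply: (tr ((1 - s) * t + s) c d i j') => //.
  - by case/andP: t01 => ? ?; apply/andP; split; nra.
  - by rewrite -E1; ring.
  - by rewrite -E2; ring.
have [a ard alt] := dist_sep RD gp gq d0.
have k1 : fl a p < fl a p + 1 <= fl a q by lia.
have [t1 t1b e1] := crossing k1.
(* A second hyperplane is either the next level of [a] or belongs to another root. *)
have [a2|a2] := ltP (fl a p + 1) (fl a q).
  have k2 : fl a p < fl a p + 1 + 1 <= fl a q by lia.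
  have [t2 t2b e2] := crossing k2.
  apply: (split a a _ _ t1 t2 k1 k2) => //.
  have d : (t2 - t1) * (pairQ a.1 q - pairQ a.1 p) = 1.
    by move: e1 e2; rewrite !intrD; lra.
  have pq : pairQ a.1 p < pairQ a.1 q.
    by move: k1; rewrite fl_ltP fl_geP => /andP[/lt_le_trans]; apply.
  by move: pq; rewrite -subr_gt0 -[t1 < t2]subr_gt0 => /pmulr_lgt0 <-; rewrite d.
have [|no] := boolP (has (fun b => [&& b != a, b != ropp a & fl b p != fl b q]) rd).
  case/hasP => b0 b0rd /and3P[n1 n2 n3].
  have [b [brd n1' n2' blt]] : exists b, [/\ b \in rd, b <> a, b <> ropp a & fl b p < fl b q].
    case: (ltgtP (fl b0 p) (fl b0 q)) n3 => // lt _.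
      by exists b0; split=> //; apply/eqP.
    exists (ropp b0); split.
    - exact: ropp_rd.
    - by move=> E; case/eqP: n2; rewrite -E /ropp /= !opprK; case: (b0).
    - by case=> /oppr_inj E1 /oppr_inj E2; case/eqP: n1; case: (b0) (a) E1 E2 => ? ? [? ?] /= -> ->.
    - by rewrite (fl_ropp gp b0rd) (fl_ropp gq b0rd); lia.
  have k2 : fl b p < fl b p + 1 <= fl b q by lia.
  have [t2 t2b e2] := crossing k2.
  case: (ltgtP t1 t2) => [lt|gt|eq].
  - exact: (split a b _ _ t1 t2 k1 k2).
  - exact: (split b a _ _ t2 t1 k2 k1).
  (* Simultaneous crossings are excluded by transversality. *)
  case: (tr t1 a b (fl a p + 1) (fl b p + 1)) => //; last by rewrite eq.
  by case/andP: t1b => /ltW-> ->.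
apply: (@gallery_adj _ a (fl a q)) => //; split=> //; first by split=> //; lia.
move=> b brd n1 n2; apply/eqP; apply: contraNT no => n3; apply/hasP.
by exists b; rewrite // n1 n2.
Qed.

(** Evaluation at the coroot of [a] gives [2 s = t * pairing b.1 a.2]; evaluation at basis vectors
    then yields the relation of [root_prop]. *)
Lemma root_lindep a b s t : a \in rd -> b \in rd -> t != 0 ->
  (forall u, s * pairQ a.1 u = t * pairQ b.1 u) -> b = a \/ b = ropp a.
Proof.
move=> ard brd t0 H; apply: (root_prop RD red) => //.
have := H (map_mx intr a.2); rewrite !pairQ_intr (pairing2 RD) // => H2.
apply/rowP => i; have := H (delta_mx 0 i).
have E (x : 'rV[int]_n) : pairQ x (delta_mx 0 i) = (x 0 i)%:~R.
  rewrite /pairQ (bigD1 i) //= !mxE !eqxx mulr1 big1 ?addr0 // => j ji.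
  by rewrite !mxE (negPf ji) andbF mulr0.
rewrite !E !mxE => H3; apply: (@intr_inj rat); rewrite !intrM.
apply: (mulfI t0); rewrite mulrCA -H3 mulrA mulrA -H2; ring.
Qed.

(* Moving p generically inside its alcove makes the segment to q cross the
   hyperplanes one at a time. *)
Lemma gallery_convex U p q : convex U -> opened U -> U p -> U q ->
  generic rd p -> generic rd q -> gallery U p q.
Proof.
move=> cU oU up uq gp gq.
pose B := (\sum_(a <- rd) (`|fl a p| + `|fl a q|).+1)%N.
pose ab := [seq z <- allpairs pair rd rd | (z.2 != z.1) && (z.2 != ropp z.1)].
pose kj := allpairs pair (krange B) (krange B).
pose f (z : (root * root) * (int * int)) : point :=
  (pairQ z.1.2.1 q - z.2.2%:~R) *: map_mx intr z.1.1.1 -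
  (pairQ z.1.1.1 q - z.2.1%:~R) *: map_mx intr z.1.2.1.
have fu z u : (f z *m u^T) 0 0 = (pairQ z.1.2.1 q - z.2.2%:~R) * pairQ z.1.1.1 u -
    (pairQ z.1.1.1 q - z.2.1%:~R) * pairQ z.1.2.1 u.
  by rewrite mulmxBl -!scalemxAl !pairQE !mxE.
have abP a b : (a, b) \in ab -> [/\ a \in rd, b \in rd, b != a & b != ropp a].
  rewrite mem_filter /= => /andP[/andP[n1 n2]].
  by case/allpairsP=> -[x y] /= [xrd yrd [ax by_]]; rewrite ax by_ in n1 n2 *.
have [u uP] : exists u, {in [seq f z | z <- allpairs pair ab kj], forall f, (f *m u^T) 0 0 != 0}.
  apply: avoid_hyperplanes => _ /mapP[[[a b] [k j]] /allpairsP[[z1 z2] [zab _ [e1 e2]]] ->].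
  subst z1 z2; have [ard brd n1 n2] := abP a b zab.
  (* The coefficient of [b] is nonzero because [q] is generic, so [f z = 0] would make the two roots
     proportional. *)
  apply/eqP => f0; have t0 : pairQ a.1 q - k%:~R != 0 by rewrite subr_eq0 gq.
  case: (@root_lindep a b (pairQ b.1 q - j%:~R) (pairQ a.1 q - k%:~R)) => //.
  - move=> w; apply/eqP; rewrite -subr_eq0.
    by have := fu ((a, b), (k, j)) w; rewrite f0 mul0mx mxE /= => <-.
  - by move/eqP: n1.
  - by move/eqP: n2.
(* This determinant vanishes if the segment from [p'] to [q] meets the hyperplanes [(a, k)] and
   [(b, j)] at the same time [t < 1]. It is affine in [p'] with linear part [- f z]. *)
pose val (p' : point) (z : (root * root) * (int * int)) :=
  (z.2.1%:~R - pairQ z.1.1.1 p') * (pairQ z.1.2.1 q - z.2.2%:~R) -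
  (z.2.2%:~R - pairQ z.1.2.1 p') * (pairQ z.1.1.1 q - z.2.1%:~R).
have valP : small_enough (fun e => {in allpairs pair ab kj, forall z, val (p + e *: u) z != 0}).
  apply: small_enough_all => z zs.
  have /small_enough_neq0 : val p z != 0 \/ - (f z *m u^T) 0 0 != 0.
    by right; rewrite oppr_eq0; apply/uP/map_f.
  apply: small_enough_imp => e _; congr (_ != _).
  by rewrite fu /val !pairQD !pairQZ; ring.
have gen0 : small_enough (fun e => generic rd (p + e *: u)).
  by apply: small_enough_generic => a ard; left=> k; apply: gp.
have /small_enough_ex[e e0 [[[up' gp'] pp'] vP]] := small_enough_and (small_enough_and
  (small_enough_and (oU p u up) gen0) (small_enough_same u gp)) valP.
set p' := p + e *: u in up' gp' pp' vP.
apply: (@gallery_trans _ p'); first exact: gallery_same.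
apply: gallery_line => // t a b k j /andP[t0 t1] ard brd Ea Eb.
have [->|n1] := eqVneq b a; first by left.
have [->|n2] := eqVneq b (ropp a); first by right.
have inB c i : c \in rd -> (1 - t) * pairQ c.1 p' + t * pairQ c.1 q = i%:~R ->
    i \in krange B.
  move=> crd E; apply: mem_krange.
  have t01 : 0 <= t <= 1 by rewrite t0.
  apply: leq_trans (crossing_bound t01 E) _.
  by rewrite -pp' // /B (big_rem c) //= leq_addr.
have zin : ((a, b), (k, j)) \in allpairs pair ab kj.
  apply: allpairs_f; last by apply: allpairs_f; [apply: (inB a)|apply: (inB b)].
  by rewrite mem_filter /= n1 n2 allpairs_f.
have := vP _ zin; rewrite /val /=.
(* At [t = 1] the point is [q], which lies on no hyperplane. *)
have t1' : 1 - t != 0.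
  apply: contraNneq (gq a k ard) => z.
  by move: Ea; rewrite z mul0r add0r (_ : t = 1) ?mul1r => [->|]; lra.
have -> : (k%:~R - pairQ a.1 p') * (pairQ b.1 q - j%:~R) -
  (j%:~R - pairQ b.1 p') * (pairQ a.1 q - k%:~R) = 0.
  by apply: (mulfI t1'); rewrite mulr0 -Ea -Eb; ring.
by rewrite eqxx.
Qed.

End Galleries.

(** * Simple transitivity on alcoves *)

Section SimpleTransitivity.
Variable n : nat.
Notation root := ('rV[int]_n * 'rV[int]_n)%type.
Notation point := 'rV[rat]_n.
Implicit Types (a b : root) (p q r u : point) (g h : elt n).
Variable rd : seq root.
Hypotheses (RD : is_root_datum rd) (red : reduced rd).

(** Reflections in the walls of the alcove of [p]; for the base alcove they lie in [S] by
    [wall_ell]. *)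
Definition wall p g := exists a k, g = aff_refl a k /\ adj rd a k p (act g p).

Lemma wall_refl p g : wall p g -> is_refl rd g.
Proof. by case=> a [k [-> [ard _ _ _ _]]]; exists a, k. Qed.

Lemma gen_wall_preserves p g : gen (wall p) g -> preserves rd g.
Proof.
move=> gP; apply: (gen_refl_preserves RD).
by move: g gP; apply: gen_trans => g /wall_refl; apply: gen_sub.
Qed.

Lemma gen_wall_inv p g : gen (wall p) g -> gen (wall p) (inv g).
Proof.
move: g; apply: gen_inv => g gW; have [a [k [e [ard _ _ _ _]]]] := gW.
by rewrite {2}e (inv_aff_refl RD) // -e; split=> //; rewrite e; apply: sref_unit ard.
Qed.

(** Pulling the common wall back by [g] gives a wall of the alcove of [p], so crossing it is right
    multiplication of [g] by a wall reflection. *)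
Lemma adj_wall a k p p' q g : preserves rd g -> generic rd p -> adj rd a k p' q ->
  same_alcove rd (act g p) p' ->
  let s := aff_refl (ract g.2 a) (k - pairing a.1 g.1) in
  [/\ wall p s, same_alcove rd (act (mul g s) p) q & mul (aff_refl a k) g = mul g s].
Proof.
move=> gP gp A gpp' s; have [ard gp' gq [ap aq] H] := A.
have E : mul (aff_refl a k) g = mul g s by apply: aff_refl_conj; case: gP.
have sq : same_alcove rd (act (mul g s) p) q.
  rewrite -E actM; apply: same_trans (adj_same RD A).
  by apply: same_act => //; apply: preserves_refl.
have grd : {in rd, forall b, ract g.2 b \in rd} by case: gP.
have sP : preserves rd s by apply: (preserves_refl RD); apply: grd.
have flE b r : fl (ract g.2 b) r = fl b (act g r) - pairing b.1 g.1.
  by rewrite fl_act addrK.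
split=> //; exists (ract g.2 a), (k - pairing a.1 g.1); split=> //; split.
- exact: grd.
- by [].
- exact: generic_act.
- by rewrite !flE -actM gpp' // sq // ap aq; split; ring.
move=> b; rewrite -(perm_mem (perm_ract RD gP)) => /mapP[c crd ->] n1 n2.
rewrite !flE -actM gpp' // sq // H //.
  by apply: contraNneq n1 => ->.
apply: contraNneq n2 => ->; rewrite /ropp /ract /= !mulNmx //.
Qed.

(** A gallery is read as a word in wall reflections. The preorder [R] is a parameter so that one
    induction serves twice: with a trivial relation for generation, and with [reach] for cyclic
    shifts. *)
Lemma gallery_follow U (R : elt n -> elt n -> Prop) p :
  generic rd p -> (forall g, R g g) ->
  (forall g h k, R g h -> R h k -> R g k) ->
  (forall g s q q', preserves rd g -> wall p s -> U q -> U q' ->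
     same_alcove rd (act g p) q -> same_alcove rd (act (mul g s) p) q' -> R g (mul g s)) ->
  forall q q', gallery rd U q q' -> forall g, preserves rd g -> same_alcove rd (act g p) q ->
  exists h, [/\ gen (wall p) h, same_alcove rd (act (mul g h) p) q' & R g (mul g h)].
Proof.
move=> gp R0 RT RS q q'; elim=> {q q'} [q q' _ _ _ _ qq|a k q q' uq uq' A|q q' q'' _ IH1 _ IH2] g gP gq.
- exists (one n); rewrite mulg1; split=> //; first exact: gen_one.
  exact: same_trans qq.
- have [sW sq _] := adj_wall gP gp A gq.
  by eexists; split; [apply: gen_sub sW | exact: sq | exact: (RS _ _ q q')].
have [h1 [h1W h1q R1]] := IH1 g gP gq.
have gh1P := preserves_mul gP (gen_wall_preserves h1W).
have [h2 [h2W h2q R2]] := IH2 _ gh1P h1q.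
exists (mul h1 h2); rewrite mulA; split=> //; first exact: gen_mul.
exact: RT R2.
Qed.

Lemma wall_transitive p q : generic rd p -> generic rd q ->
  exists2 g, gen (wall p) g & same_alcove rd (act g p) q.
Proof.
move=> gp gq.
have G : gallery rd (fun=> True) p q.
  by apply: gallery_convex => // ? ? _; exists (1 : rat).
have one_p : same_alcove rd (act (one n) p) p by rewrite act1.
have [h [hW hq _]] := @gallery_follow _ (fun _ _ => True) p gp (fun _ => I)
  (fun _ _ _ _ _ => I) (fun _ _ _ _ _ _ _ _ _ _ => I) _ _ G _ (preserves_one rd) one_p.
by exists h; rewrite // mul1g in hq.
Qed.

(* A point of the hyperplane of (a, k) lying on no other hyperplane. *)
Lemma adj_exists a (k : int) : a \in rd -> exists p q, adj rd a k p q.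
Proof.
move=> ard; pose others := [seq b <- rd | (b != a) && (b != ropp a)].
(* This form is [2 b] on the kernel of [a] and zero on the coroot of [a]; hence [f b] at [u0] is
   twice [b] at the projection [u] of [u0] to that kernel. *)
pose f b : point := map_mx intr (2 *: b.1 - pairing b.1 a.2 *: a.1).
have [u0 u0P] : exists u, {in map f others, forall f, (f *m u^T) 0 0 != 0}.
  apply: avoid_hyperplanes => _ /mapP[b + ->]; rewrite mem_filter => /andP[/andP[/eqP n1 /eqP n2] brd].
  apply/eqP => /rowP fb0; case: (root_prop RD red ard brd) => //.
  apply/rowP => i; have /eqP := fb0 i; rewrite !mxE intr_eq0 subr_eq0 => /eqP.
  by [].
have faE : pairQ a.1 (map_mx intr a.2) = 2 by rewrite pairQ_intr (pairing2 RD).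
pose av : point := map_mx intr a.2.
pose u := u0 - (pairQ a.1 u0 / 2) *: av.
have au : pairQ a.1 u = 0 by rewrite pairQB pairQZ faE divfK // subrr.
pose r0 := (k%:~R / 2) *: av.
have ar0 : pairQ a.1 r0 = k%:~R by rewrite pairQZ faE divfK.
have bu b : b \in others -> pairQ b.1 u != 0.
  move=> bo; have := u0P (f b) (map_f _ bo).
  rewrite -pairQE pairQDl -scaleNr !pairQZl rmorphN /= => nz.
  apply: contraNneq nz; rewrite pairQB pairQZ pairQ_intr => E.
  by apply/eqP; rewrite -[RHS](mulr0 2) -E; field.
have /small_enough_ex[e e0 He] : small_enough (fun e => {in others, forall b,
    forall j : int, pairQ b.1 (r0 + e *: u) != j%:~R}).
  apply: small_enough_all => b /bu bu0.
  have /small_enough_nonint := or_intror (forall k : int, pairQ b.1 r0 != k%:~R) bu0.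
  by apply: small_enough_imp => e _ H j; rewrite pairQD pairQZ.
set r := r0 + e *: u in He.
have ar : pairQ a.1 r = k%:~R by rewrite pairQD ar0 pairQZ au mulr0 addr0.
have gen_near (c : rat) : c != 0 -> small_enough (fun e => generic rd (r + e *: (c *: av))).
  move=> c0; apply: small_enough_generic => b brd.
  have [->|n1] := eqVneq b a; first by right; rewrite pairQZ faE mulf_neq0.
  have [->|n2] := eqVneq b (ropp a).
    by right; rewrite pairQZ pairQNl faE mulf_neq0.
  by left; apply: He; rewrite mem_filter n1 n2.
have fl_near (c : rat) : small_enough (fun e => {in others, forall b,
    fl b r = fl b (r + e *: (c *: av))}).
  by apply: small_enough_all => b /He; apply: small_enough_fl.
(* The two alcoves are reached from [r] along plus and minus the coroot. As [a] takes the value 2 on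
   it, [2 d < 1] keeps [a] within 1 of [k]. *)
have n1 : -1 != 0 :> rat by [].
have /small_enough_ex[d d0 [[[[H1 H2] H3] H4] d1]] := small_enough_and (small_enough_and
  (small_enough_and (small_enough_and (gen_near 1 (oner_neq0 _)) (gen_near _ n1))
   (fl_near 1)) (fl_near (-1))) (small_enough_lt 2 0 (ltr01 : 0 < 1 :> rat)).
exists (r + d *: (-1 *: av)), (r + d *: (1 *: av)); split=> //.
  by split; apply: flP; rewrite ?intrB pairQD !pairQZ faE ar; apply/andP; split; lra.
by move=> b brd m1 m2; rewrite -H3 -?H4 // mem_filter m1 m2.
Qed.

(** Carry the alcove of [p] by a product [h] of wall reflections to an alcove touching the given
    hyperplane; its reflection is then the conjugate by [h] of a wall reflection. *)
Lemma wall_gen p g : generic rd p -> gen (is_refl rd) g -> gen (wall p) g.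
Proof.
move=> gp; move: g; apply: gen_trans => _ [a [k [ard ->]]].
have [q [q' A]] := adj_exists k ard.
have [h hW hq] := wall_transitive gp (let: And5 _ gq _ _ _ := A in gq).
have hP := gen_wall_preserves hW.
have [sW _ E] := adj_wall hP gp A hq.
rewrite -[aff_refl a k](@mulgK _ h); last by case: hP.
rewrite E; apply: gen_mul; last exact: gen_wall_inv.
by apply: gen_mul => //; apply: gen_sub.
Qed.

Lemma wprod_switch (C : elt n -> bool) g t : C g -> ~~ C (mul g (wprod t)) ->
  exists t1 h t2, [/\ t = t1 ++ h :: t2, C (mul g (wprod t1)) &
    ~~ C (mul (mul g (wprod t1)) h)].
Proof.
elim: t g => [|h t IH] g Cg /=; first by rewrite mulg1 Cg.
rewrite mulA; have [Cgh|nCgh _] := boolP (C (mul g h)).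
  move/(IH _ Cgh) => [t1 [h' [t2 [-> H1 H2]]]].
  by exists (h :: t1), h', t2; rewrite /= mulA.
by exists [::], h, t; rewrite /= mulg1.
Qed.

(* Deletion: a closed gallery recrosses its first wall; reflect the part of the
   gallery in between. *)
Lemma refl_free p g : generic rd p -> gen (is_refl rd) g -> same_alcove rd (act g p) p ->
  g = one n.
Proof.
move=> gp /(wall_gen gp)[s + {g}->]; move: {2}(size s) (leqnn (size s)) => m.
elim: m s => [|m IH] [|h1 t] // sz sW sp.
have [a [k [e1 [ard _ _ [ap as1] _]]]] : wall p h1 by apply: sW; rewrite mem_head.
have tW h : h \in t -> wall p h by move=> ht; apply: sW; rewrite inE ht orbT.
have [||t1 [h [t2 [et C1 C2]]]] := @wprod_switch (fun g => k <= fl a (act g p)) h1 t.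
- by rewrite as1.
- by rewrite -[mul _ _]/(wprod (h1 :: t)) sp // ap; lia.
set g := mul h1 (wprod t1) in C1 C2.
have prodP w : {subset w <= t} -> preserves rd (wprod w).
  by move=> ut; apply: (@gen_wall_preserves p); exists w => // h' /ut /tW.
have h1P : preserves rd h1.
  by apply: (@gen_wall_preserves p); apply/gen_sub/sW/mem_head.
have gP : preserves rd g.
  by apply: preserves_mul => //; apply: prodP => x; rewrite et mem_cat => ->.
have [b [j [eh [brd _ _ [bp bh] H]]]] : wall p h.
  by apply: tW; rewrite et mem_cat mem_head orbT.
have hP : preserves rd h by rewrite eh; apply: preserves_refl.
have gard : ract g.2 a \in rd by case: gP => _; apply.
rewrite fl_act in C1; rewrite actM fl_act in C2.
(* The first letter and the letter [h] cross the same hyperplane, so both can be deleted from the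
   word. *)
have cross : mul h1 g = mul g h.
  rewrite e1 aff_refl_conj; last by case: gP.
  congr (mul g _); rewrite eh.
  (* Crossing [h] changes the floors of [b] and its opposite only, so the pulled-back root is one of
     these. *)
  have [E|n1] := eqVneq (ract g.2 a) b.
    by move: C1 C2; rewrite E bp bh; lia.
  have [E|n2] := eqVneq (ract g.2 a) (ropp b).
    rewrite E -(aff_refl_ropp b); congr (aff_refl _ _).
    move: C1 C2; rewrite E (fl_ropp gp brd) (fl_ropp (generic_act hP gp) brd) bp bh; lia.
  by move: C1 C2; rewrite H //; lia.
have hh : mul h1 h1 = one n by rewrite e1 (aff_refl_sqr RD).
have E : wprod (h1 :: t) = wprod (t1 ++ t2).
  by rewrite /= et !wprod_cat /= mulA -/g mulA -cross /g mulA hh mul1g.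
rewrite E; apply: IH; last by rewrite -E.
  by move: sz; rewrite et /= !size_cat /=; lia.
by move=> x xt; apply: tW; move: xt; rewrite et !mem_cat inE => /orP[->|->]; rewrite ?orbT.
Qed.

End SimpleTransitivity.

(** * Averaging periodic sequences *)

Section Averaging.
Implicit Types (e : nat -> rat) (m N : nat).

Definition average e : nat -> rat := fun i => (e i + e i.+1) / 2.
Definition periodic m e := forall i, e (m + i)%N = e i.

Lemma window m e : periodic m e -> forall i,
  \sum_(j < m) e (i + j)%N = \sum_(j < m) e j.
Proof.
move=> per; elim=> [|i <-]; first by apply: eq_bigr.
apply: (addrI (e i)); rewrite -{1}(addn0 i).
have -> : \sum_(j < m) e (i.+1 + j)%N = \sum_(j < m) e (i + j.+1)%N.
  by apply: eq_bigr => j _; rewrite addSnnS.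
rewrite -(big_ord_recl m (fun j : 'I_m.+1 => e (i + j)%N)) big_ord_recr /=.
by rewrite addrC addnC per.
Qed.

Lemma average_periodic m e : periodic m e -> periodic m (average e).
Proof. by move=> per i; rewrite /average -addnS !per. Qed.

Lemma average_sum m e : periodic m e ->
  \sum_(j < m) average e j = \sum_(j < m) e j.
Proof.
move=> per; rewrite -mulr_suml big_split /=.
by rewrite [X in _ + X](window per 1%N); field.
Qed.

Lemma iter_average_periodic m e N : periodic m e ->
  periodic m (iter N average e) /\
  \sum_(j < m) iter N average e j = \sum_(j < m) e j.
Proof.
move=> per; elim: N => [|N [IH1 IH2]] //=.
by split; [apply: average_periodic | rewrite average_sum].
Qed.

(* Every binomial coefficient is at least one. *)
Lemma average_lower_bound e l N i : (forall i, l <= e i) ->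
  l + (\sum_(j < N.+1) (e (i + j)%N - l)) / 2 ^+ N <= iter N average e i.
Proof.
move=> le; elim: N i => [|N IH] i /=.
  by rewrite big_ord1 addn0 expr0 divr1 addrC subrK.
have := IH i; have := IH i.+1; rewrite /average exprS.
set w := 2 ^+ N; have w0 : 0 < w by rewrite exprn_gt0.
have S1 : \sum_(j < N.+1) (e (i.+1 + j)%N - l) =
    \sum_(j < N.+2) (e (i + j)%N - l) - (e i - l).
  rewrite [in RHS]big_ord_recl /= addn0 addrAC subrr add0r.
  by apply: eq_bigr => j _; rewrite addSnnS.
have S2 : e i - l <= \sum_(j < N.+1) (e (i + j)%N - l).
  rewrite big_ord_recl addn0 lerDl; apply: sumr_ge0 => j _.
  by rewrite subr_ge0.
rewrite S1; set A := \sum_(j < N.+2) _; set B := \sum_(j < N.+1) _ in S2 *.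
move=> H1 H2.
have H3 : (e i - l) / w <= B / w by rewrite ler_pM2r ?invr_gt0.
have -> : A / (2 * w) = A / w / 2 by rewrite invfM mulrA mulrAC.
by move: H1 H2; rewrite mulrBl; lra.
Qed.

(** By [average_lower_bound], [m] averagings raise a nonpositive lower bound by [d = S / 2 ^+ m]. A
    periodic sequence is bounded, so finitely many rounds lift the bound to 0, and positivity then
    persists. *)
Lemma average_eventually_pos m e : periodic m e -> 0 < \sum_(j < m) e j ->
  exists N0, forall N, (N0 <= N)%N -> forall i, 0 < iter N average e i.
Proof.
move=> per S0; set S := \sum_(j < m) e j in S0.
suff [N0 H] : exists N0, forall i, 0 < iter N0 average e i.
  exists N0 => N /subnK <-; elim: (N - N0)%N => //= k IH i.
  by rewrite divr_gt0 // addr_gt0.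
pose d := S / 2 ^+ m.
have d0 : 0 < d by rewrite divr_gt0 // exprn_gt0.
have [k kP] : exists k : nat, forall i, - (k%:R * d) < e i.
  have m0 : (0 < m)%N by rewrite lt0n; apply: contraTneq S0 => m0; rewrite /S m0 big_ord0 ltxx.
  pose M := \sum_(j < m) `|e j|.
  have M0 : 0 <= M by apply: sumr_ge0 => j _.
  have := archi_boundP (divr_ge0 M0 (ltW d0)); set k := Num.bound _ => Mk.
  have {}Mk : M < k%:R * d by rewrite -ltr_pdivrMr.
  exists k => i; have -> : e i = e (i %% m)%N.
    rewrite {1}(divn_eq i m); elim: (i %/ m)%N => // j IH.
    by rewrite mulSn -addnA per.
  have : `|e (i %% m)%N| <= M.
    rewrite /M (bigD1 (Ordinal (ltn_pmod i m0))) //= lerDl.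
    by apply: sumr_ge0.
  by have := ler_norm (- e (i %% m)%N); rewrite normrN; lra.
suff H : forall f, periodic m f -> (forall i, - (k%:R * d) < f i) ->
    \sum_(j < m) f j = S -> exists N, forall i, 0 < iter N average f i.
  exact: H per kP _.
elim: k {kP} => [|k IH] f {}per kP eS.
  by exists 0%N => i; have := kP i; rewrite mul0r oppr0.
set l := - (k.+1%:R * d) in kP.
have l0 : l <= 0 by rewrite oppr_le0 mulr_ge0 // ltW.
have [per' sum'] := iter_average_periodic m per.
have [||N H] := IH _ per'; [|by rewrite sum'|].
  move=> i; apply: lt_le_trans (average_lower_bound m i (fun j => ltW (kP j))).
  (* The first [m] terms sum to [S - l *+ m], at least [S] since [l <= 0]; the extra term makes the
     bound strict. *)
  rewrite big_ord_recr /= sumrB (window per) eS sumr_const card_ord.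
  have : 0 < f (i + m)%N - l by rewrite subr_gt0.
  set r := f _ - l => r0.
  have -> : - (k%:R * d) = l + S / 2 ^+ m.
    by rewrite /l -/d -addn1 natrD; ring.
  rewrite ltrD2l ltr_pM2r ?invr_gt0 ?exprn_gt0 //.
  have : l *+ m <= 0 by rewrite mulrn_wle0.
  lra.
by exists (N + m)%N => i; rewrite iterD.
Qed.

End Averaging.

(** * Total variation of integer sequences against net change *)

Section Telescope.
Implicit Types (f : nat -> int) (m : nat).

Lemma abs_telescope f m :
  (`|(f 0%N - f m)%R| <= \sum_(i < m) `|(f i - f i.+1)%R|)%N.
Proof.
elim: m => [|m IH]; first by lia.
by rewrite big_ord_recr; move: IH; set A := (\sum_(i < m) _)%N; rewrite /=; lia.
Qed.

(** An initial step down must be made up for later, which costs extra variation. *)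
Lemma abs_telescope_lt f m : (0 < m)%N -> f 1%N < f 0%N -> f 0%N <= f m ->
  (`|(f 0%N - f m)%R| < \sum_(i < m) `|(f i - f i.+1)%R|)%N.
Proof.
case: m => // m _ lt le; rewrite big_ord_recl; set A := (\sum_(i < m) _)%N.
have : (`|(f 1%N - f m.+1)%R| <= A)%N := abs_telescope (fun i => f i.+1) m.
by rewrite /=; lia.
Qed.

Lemma abs_telescope_mono f m : (forall i, f i <= f i.+1) \/ (forall i, f i.+1 <= f i) ->
  (\sum_(i < m) `|(f i - f i.+1)%R| = `|(f 0%N - f m)%R|)%N.
Proof.
case=> H.
  suff /andP[_ /eqP] : (f 0%N <= f m) && (\sum_(i < m) `|(f i - f i.+1)%R| == `|(f 0%N - f m)%R|)%N.
    by [].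
  elim: m => [|m IH]; first by rewrite big_ord0; lia.
  by rewrite big_ord_recr; move: IH (H m); set A := (\sum_(i < m) _)%N; rewrite /=; lia.
suff /andP[_ /eqP] : (f m <= f 0%N) && (\sum_(i < m) `|(f i - f i.+1)%R| == `|(f 0%N - f m)%R|)%N.
  by [].
elim: m => [|m IH]; first by rewrite big_ord0; lia.
by rewrite big_ord_recr; move: IH (H m); set A := (\sum_(i < m) _)%N; rewrite /=; lia.
Qed.

End Telescope.

(** * A power acting trivially on the roots *)

Section FiniteOrder.
Variable n : nat.
Notation root := ('rV[int]_n * 'rV[int]_n)%type.
Implicit Types (a b : root) (g : elt n).
Variable rd : seq root.

Lemma ract_pow g m a : g.2 \in unitmx -> ract (pow g m).2 a = iter m (ract g.2) a.
Proof.
move=> gu.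
have pu k : (pow g k).2 \in unitmx.
  by elim: k => [|k IH]; [apply: unitmx1 | apply: unitmx_mulg].
elim: m a => [|m IH] a; first by rewrite /ract trmx1 invmx1 !mulmx1; case: a.
by rewrite iterSr -IH -ractM.
Qed.

Lemma pow_fix_roots g : preserves rd g ->
  exists2 m, (0 < m)%N & {in rd, forall a, ract (pow g m).2 a = a}.
Proof.
case=> gu gP.
pose F (z : seq_sub rd) : seq_sub rd := SeqSub (gP _ (valP z)).
have Fi : injective F.
  by move=> z t /(congr1 val) /(can_inj (ractK gu)) /val_inj.
have valF k z : val (iter k F z) = iter k (ract g.2) (val z).
  by elim: k => //= k ->.
(* The product of the cycle lengths is a multiple of each of them. *)
exists (\prod_(z : seq_sub rd) fingraph.order F z)%N.
  by rewrite prodn_gt0 // => z; apply: fingraph.order_gt0.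
move=> a ard; rewrite ract_pow // -[a]/(val (SeqSub ard)) -valF; congr val.
rewrite (bigD1 (SeqSub ard)) //= mulnC iterM.
by elim: (\prod_(_ | _) _)%N => //= k ->; rewrite fingraph.iter_order.
Qed.

End FiniteOrder.

(** * Good alcoves of a straight element *)

Section NewtonPoint.
Variable n : nat.
Notation root := ('rV[int]_n * 'rV[int]_n)%type.
Notation point := 'rV[rat]_n.
Implicit Types (a b : root) (p q z : point) (g h : elt n).
Variables (rd : seq root) (x : elt n) (m : nat).
Hypotheses (RD : is_root_datum rd) (red : reduced rd) (xP : preserves rd x).
Hypotheses (m0 : (0 < m)%N) (xm : {in rd, forall a, ract (pow x m).2 a = a}).

(* On the roots, x ^ m is the translation by mu; mu / m is the Newton point. *)
Definition mu := (pow x m).1.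
Definition drift : nat := (\sum_(a <- rd) `|pairing a.1 mu|)%N.
(* By [drift_le] this is an equality.  Since [dist] counts every hyperplane once
   for each of its two roots, it says that w_C is straight for the alcove C of q. *)
Definition good q := (m * dist rd q (act x q) <= drift)%N.
Definition rdmu := [seq a <- rd | pairing a.1 mu == 0].
(** Kept as a convex combination with parameter [1 / 2] to fit [act_affine] and [pairQ_conv]. *)
Definition mid q : point := (1 - 1 / 2) *: q + (1 / 2) *: act x q.

Lemma pairQ_iterm a q : a \in rd ->
  pairQ a.1 (iter m (act x) q) = pairQ a.1 q + (pairing a.1 mu)%:~R.
Proof. by move=> ard; rewrite -act_pow pairQ_act xm. Qed.

Lemma fl_iterm a q : a \in rd ->
  fl a (iter m (act x) q) = fl a q + pairing a.1 mu.
Proof. by move=> ard; rewrite -act_pow fl_act xm. Qed.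

Lemma ract_rd a : a \in rd -> ract x.2 a \in rd.
Proof. by case: xP => _; apply. Qed.

(** [x] commutes with its power [x ^ m], which acts trivially on the roots; compare translation
    parts. *)
Lemma pairing_ract_mu a : a \in rd -> pairing (ract x.2 a).1 mu = pairing a.1 mu.
Proof.
move=> ard; rewrite /= -pairing_mulr.
have /(congr1 (fun g => pairing a.1 g.1)) := pow_comm x m.
rewrite /= !pairingDr [pairing a.1 (x.1 *m _)]pairing_mulr.
by rewrite -[a.1 *m _]/((ract (pow x m).2 a).1) xm // addrC => /addrI.
Qed.

Lemma iter_preserves_generic i q : generic rd q -> generic rd (iter i (act x) q).
Proof. by move=> gq; elim: i => //= i; apply: generic_act. Qed.

Lemma drift_dist q : dist rd q (iter m (act x) q) = drift.
Proof.
by apply: eq_big_seq => a ard; rewrite fl_iterm // opprD addNKr abszN.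
Qed.

(** [x] preserves [dist], so the first [m] steps of the orbit of [q] have equal length; then sum
    root by root. *)
Lemma dist_steps q : (m * dist rd q (act x q) =
  \sum_(a <- rd) \sum_(i < m)
    `|(fl a (iter i (act x) q) - fl a (iter i.+1 (act x) q))%R|)%N.
Proof.
rewrite exchange_big /=.
transitivity (\sum_(i < m) dist rd q (act x q))%N.
  by rewrite sum_nat_const card_ord.
apply: eq_bigr => i _; elim: (nat_of_ord i) => //= k ->.
by rewrite -[LHS](dist_act RD _ _ xP).
Qed.

Lemma drift_le q : (drift <= m * dist rd q (act x q))%N.
Proof.
rewrite dist_steps -(drift_dist q); apply: leq_sum => a _.
exact: (abs_telescope (fun i => fl a (iter i (act x) q))).
Qed.

Lemma goodE q : good q -> (m * dist rd q (act x q) = drift)%N.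
Proof. by move=> gq; apply/eqP; rewrite eqn_leq drift_le andbT. Qed.

(** A backward step for [a] would make its variation along the orbit exceed its net displacement,
    and the total would exceed [drift]. *)
Lemma good_fl q a : good q -> a \in rd -> 0 <= pairing a.1 mu ->
  fl a q <= fl a (act x q).
Proof.
move=> gq ard a0; rewrite leNgt; apply/negP => lt.
move: gq; rewrite /good leqNgt dist_steps -(drift_dist q) => /negP; apply.
rewrite /dist !(big_rem a ard) /= -addSn; apply: leq_add.
  apply: (abs_telescope_lt (f := fun i => fl a (iter i (act x) q)) m0 lt).
  by rewrite /= fl_iterm // lerDl.
apply: leq_sum => b _.
exact: (abs_telescope (fun i => fl b (iter i (act x) q))).
Qed.

(** [x] permutes the roots and keeps their pairing with [mu], so the condition on the first step
    holds at every step of the orbit. Each floor is then monotone and its variation equals its net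
    change. *)
Lemma fl_good q : generic rd q ->
  (forall a, a \in rd -> 0 <= pairing a.1 mu -> fl a q <= fl a (act x q)) -> good q.
Proof.
move=> gq H; rewrite /good dist_steps -(drift_dist q) leq_eqVlt; apply/orP; left.
apply/eqP; apply: eq_big_seq => a ard.
have up b i : b \in rd -> 0 <= pairing b.1 mu ->
    fl b (iter i (act x) q) <= fl b (iter i.+1 (act x) q).
  elim: i b => [|i IH] b brd b0; first exact: H.
  by rewrite !iterS !(fl_act b) lerD2r; apply: IH; rewrite ?ract_rd // pairing_ract_mu.
apply: (abs_telescope_mono (f := fun i => fl a (iter i (act x) q))).
have [a0|/ltW a0] := leP 0 (pairing a.1 mu); first by left=> i; apply: up.
right=> i; have gi k := iter_preserves_generic k gq.
have := up (ropp a) i (ropp_rd RD ard).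
by rewrite pairingNl oppr_ge0 (fl_ropp (gi i) ard) (fl_ropp (gi i.+1) ard) => /(_ a0); lia.
Qed.

(** Here [d(z, xz) <= d(z, xq) + d(xq, xz) = d(z, xq) + d(q, z) = d(q, xq)]. *)
Lemma good_between q z :
  {in rd, forall a, (fl a q <= fl a z <= fl a (act x q)) ||
                    (fl a (act x q) <= fl a z <= fl a q)} ->
  good q -> good z.
Proof.
move=> btw; apply: leq_trans; rewrite leq_mul2l; apply/orP; right.
rewrite (dist_between btw) addnC -(dist_act RD q z xP).
exact: dist_triangle.
Qed.

Lemma good_same q q' : same_alcove rd q q' -> good q -> good q'.
Proof.
move=> qq; rewrite /good (dist_same qq (same_act xP qq)); exact.
Qed.

(** * The subsystem orthogonal to [mu] and the elements commuting with [x] *)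

Lemma rdmuP a : (a \in rdmu) = (a \in rd) && (pairing a.1 mu == 0).
Proof. by rewrite mem_filter andbC. Qed.

Lemma rdmu_sub : {subset rdmu <= rd}.
Proof. by move=> a; rewrite rdmuP => /andP[]. Qed.

Lemma rdmu_datum : is_root_datum rdmu.
Proof.
case: (RD) => u1 u2 H1 H2; split.
- exact: (subseq_uniq (map_subseq _ (filter_subseq _ _))) u1.
- exact: (subseq_uniq (map_subseq _ (filter_subseq _ _))) u2.
- by move=> a /rdmu_sub; apply: H1.
move=> a b; rewrite !rdmuP => /andP[ard /eqP a0] /andP[brd /eqP b0].
by rewrite H2 //= pairingDl pairingNl pairingZl a0 b0 mulr0 subr0.
Qed.

Lemma rdmu_reduced : reduced rdmu.
Proof.
move=> a /rdmu_sub /red; apply: contra => /mapP[b /rdmu_sub brd ->].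
exact: map_f.
Qed.

Lemma rdmu_preserves : preserves rdmu x.
Proof.
case: (xP) => xu _; split=> // a; rewrite !rdmuP => /andP[ard a0].
by rewrite ract_rd // pairing_ract_mu.
Qed.

(** Roots of [rdmu] satisfy [good_fl] together with their opposites, so their floors cannot
    change. *)
Lemma good_rdmu q : generic rd q -> good q -> same_alcove rdmu q (act x q).
Proof.
move=> gq q_good a; rewrite rdmuP => /andP[ard /eqP a0].
have := good_fl q_good ard; rewrite a0 lexx => /(_ isT).
have := good_fl q_good (ropp_rd RD ard); rewrite pairingNl a0 oppr0 lexx => /(_ isT).
by rewrite (fl_ropp gq ard) (fl_ropp (generic_act xP gq) ard); lia.
Qed.

Lemma generic_rdmu q : generic rd q -> generic rdmu q.
Proof. by move=> gq a k /rdmu_sub; apply: gq. Qed.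

Lemma conj_gen_refl rd0 (z : elt n) : preserves rd0 x -> is_root_datum rd0 ->
  gen (is_refl rd0) z -> gen (is_refl rd0) (mul (mul x z) (inv x)).
Proof.
move=> xP0 RD0; have xu : x.2 \in unitmx by case: xP0.
move: z; apply: gen_closed.
- by rewrite mulg1 mulgV //; apply: gen_one.
- move=> g h gP hP; have := gen_mul gP hP.
  by rewrite !mulA mulgKV // -!mulA.
move=> _ [a [k [ard ->]]]; rewrite -mulA aff_refl_conj ?unitmx_invg // mulKVg //.
apply: gen_sub; eexists; eexists; split; last by [].
by case: (preserves_inv RD0 xP0) => _; apply.
Qed.

(** [x] stabilises the alcoves of [rdmu] at [q] and [q'], so [z] and its conjugate by [x] both carry
    the first to the second; [refl_free] identifies them. *)
Lemma centralizer_transitive q q' : generic rd q -> generic rd q' ->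
  good q -> good q' ->
  exists z : elt n, [/\ gen (is_refl rdmu) z, mul x z = mul z x & same_alcove rdmu (act z q) q'].
Proof.
move=> gq gq' q_good q_good'.
have xu : x.2 \in unitmx by case: xP.
have [z zW zq] := refl_transitive rdmu_datum (generic_rdmu gq) (generic_rdmu gq').
exists z; split=> //.
have zP := gen_refl_preserves rdmu_datum zW.
have zu : z.2 \in unitmx by case: zP.
set c := mul (mul x z) (inv x).
have cW : gen (is_refl rdmu) c := conj_gen_refl rdmu_preserves rdmu_datum zW.
have cP := gen_refl_preserves rdmu_datum cW.
have cq : same_alcove rdmu (act c q) (act z q).
  apply: same_trans (same_act cP (good_rdmu gq q_good)) _.
  rewrite -actM /c mulgKV // actM.
  apply: same_trans (same_act rdmu_preserves zq) _.
  apply: same_trans (same_sym zq).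
  exact/same_sym/good_rdmu.
have u1 : mul (inv z) c = one n.
  apply: (refl_free rdmu_datum rdmu_reduced (generic_rdmu gq)).
    by apply: gen_mul => //; apply: gen_refl_inv rdmu_datum _ zW.
  rewrite actM; have := same_act (preserves_inv rdmu_datum zP) cq.
  by rewrite actK.
have cz : c = z by rewrite -[c](mulKVg _ zu) u1 mulg1.
by rewrite -{2}cz /c mulgKV.
Qed.

Lemma mulg_good (z : elt n) q : preserves rd z -> mul x z = mul z x -> good q -> good (act z q).
Proof.
by move=> zP xz; rewrite /good -actM xz actM (dist_act RD).
Qed.

Lemma pairQ_conv a (t : rat) p q :
  pairQ a.1 ((1 - t) *: p + t *: q) = (1 - t) * pairQ a.1 p + t * pairQ a.1 q.
Proof. by rewrite pairQD !pairQZ. Qed.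

(** A convex open set whose generic points lie in the alcoves on minimal galleries from [q] to
    [x q]. *)
Definition hull q z := forall a, a \in rd ->
  (Num.min (fl a q) (fl a (act x q)))%:~R < pairQ a.1 z <
  (Num.max (fl a q) (fl a (act x q)))%:~R + 1.

Lemma hull_convex q : convex (hull q).
Proof.
move=> p p' t t01 Hp Hp' a ard; rewrite pairQ_conv.
have /andP[? ?] := Hp a ard; have /andP[? ?] := Hp' a ard.
by apply/andP; split; [apply: conv_gt | apply: conv_lt].
Qed.

Lemma hull_open q : opened (hull q).
Proof.
move=> p u Hp; apply: small_enough_all => a /Hp /andP[H1 H2].
have := small_enough_and (small_enough_lt 0 (pairQ a.1 u) H1)
  (small_enough_lt (pairQ a.1 u) 0 H2).
apply: small_enough_imp => e _; rewrite !mulr0 !addr0 pairQD pairQZ.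
by case=> -> ->.
Qed.

Lemma hull_good q z : good q -> hull q z -> good z.
Proof.
move=> gq Hz; apply: good_between gq => a /Hz /andP[H1 H2].
have : Num.min (fl a q) (fl a (act x q)) <= fl a z by rewrite fl_geP ltW.
have : fl a z < Num.max (fl a q) (fl a (act x q)) + 1 by rewrite fl_ltP intrD.
lia.
Qed.

Lemma hull_ends q : generic rd q -> hull q q /\ hull q (act x q).
Proof.
move=> gq; have gxq := generic_act xP gq; split=> a ard; apply/andP; split.
- by apply: le_lt_trans (fl_lt gq ard); rewrite ler_int ge_min lexx.
- have /andP[_ lt] := fl_bounds a q; apply: (lt_le_trans lt).
  by rewrite lerD2r ler_int le_max lexx.
- by apply: le_lt_trans (fl_lt gxq ard); rewrite ler_int ge_min lexx orbT.
- have /andP[_ lt] := fl_bounds a (act x q); apply: (lt_le_trans lt).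
  by rewrite lerD2r ler_int le_max lexx orbT.
Qed.

Lemma half01 : 0 <= (1 / 2 : rat) <= 1. Proof. by []. Qed.

Lemma hull_mid q : generic rd q -> hull q (mid q).
Proof. by case/hull_ends => H1 H2; apply: hull_convex half01 _ _. Qed.

Lemma gallery_mid q : generic rd q -> generic rd (mid q) -> good q ->
  gallery rd good q (mid q).
Proof.
move=> gq gm q_good; have [Hq _] := hull_ends gq.
apply: (@gallery_sub _ _ (hull q)) => [r _|]; first exact: hull_good.
apply: gallery_convex => //.
- exact: hull_convex.
- exact: hull_open.
- exact: hull_mid.
Qed.

Lemma gallery_iter_mid q M : good q ->
  (forall N, (N <= M)%N -> generic rd (iter N mid q)) ->
  gallery rd good q (iter M mid q) /\ good (iter M mid q).
Proof.
move=> q_good; elim: M => [|M IH] H.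
  by split=> //; have gq := H 0%N isT; apply: gallery_same.
have [|IH1 IH2] := IH; first by move=> N NM; apply: H; apply: leqW.
have gM := H M (leqnSn M); split.
  by apply: gallery_trans IH1 _; apply: gallery_mid => //; apply: (H M.+1).
exact: hull_good IH2 (hull_mid gM).
Qed.

Lemma act_iter_mid i N q :
  iter i (act x) (iter N.+1 mid q) =
  (1 - 1 / 2) *: iter i (act x) (iter N mid q) +
  (1 / 2) *: iter i.+1 (act x) (iter N mid q).
Proof. by elim: i => //= i ->; rewrite act_affine. Qed.

Definition speed a q (i : nat) : rat :=
  pairQ a.1 (iter i.+1 (act x) q) - pairQ a.1 (iter i (act x) q).

(** Since [x] acts affinely, passing to [mid] replaces each displacement by its mean with the next
    one. *)
Lemma speed_mid a q N i : speed a (iter N mid q) i = iter N average (speed a q) i.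
Proof.
elim: N i => // N IH i.
transitivity ((iter N average (speed a q) i + iter N average (speed a q) i.+1) / 2) => //.
by rewrite -!IH /speed !act_iter_mid !pairQ_conv; field.
Qed.

Lemma speed_mid_pos q : exists M, forall a, a \in rd -> 0 < pairing a.1 mu ->
  pairQ a.1 (iter M mid q) < pairQ a.1 (act x (iter M mid q)).
Proof.
(* Positivity is asked for all [N] beyond [M], so the bounds for the finitely many roots can be
   combined by a maximum. *)
suff [M H] : exists M, forall N, (M <= N)%N -> {in rd, forall a, 0 < pairing a.1 mu ->
    0 < iter N average (speed a q) 0}.
  exists M => a ard a0; have := H M (leqnn M) a ard a0.
  by rewrite -speed_mid /speed subr_gt0.
have one a : a \in rd -> exists M, forall N, (M <= N)%N ->
    0 < pairing a.1 mu -> 0 < iter N average (speed a q) 0.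
  move=> ard; have [a0|] := ltP 0 (pairing a.1 mu); last by exists 0%N.
  have per : periodic m (speed a q).
    move=> i; rewrite /speed -addnS !iterD !pairQ_iterm //; ring.
  have sum : \sum_(j < m) speed a q j = (pairing a.1 mu)%:~R.
    transitivity (pairQ a.1 (iter m (act x) q) - pairQ a.1 q).
      by rewrite -(telescope_sumr (fun i => pairQ a.1 (iter i (act x) q)) (leq0n m)) big_mkord.
    by rewrite pairQ_iterm // addrC addKr.
  have [|M HM] := average_eventually_pos per; first by rewrite sum ltr0z.
  by exists M => N MN _; apply: HM.
have sub : {subset rd <= rd} by [].
elim: {-2}rd sub => [|b s IH] bs; first by exists 0%N.
have [|M1 H1] := IH; first by move=> c cs; apply: bs; rewrite inE cs orbT.
have [M2 H2] := one b (bs b (mem_head _ _)).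
exists (maxn M1 M2) => N; rewrite geq_max => /andP[N1 N2] a.
by rewrite inE => /predU1P[->|as_]; [apply: H2 | apply: H1].
Qed.

(** The alcove of [rdmu] around [q0], restricted to points that [x] moves strictly forward for every
    root positive on [mu]. *)
Definition fundamental q0 z :=
  (forall a, a \in rdmu -> (fl a q0)%:~R < pairQ a.1 z < (fl a q0)%:~R + 1) /\
  (forall a, a \in rd -> 0 < pairing a.1 mu -> pairQ a.1 z < pairQ a.1 (act x z)).

Lemma fundamental_convex q0 : convex (fundamental q0).
Proof.
move=> p p' t t01 [Hp Kp] [Hp' Kp']; split=> a ard.
  rewrite pairQ_conv; have /andP[? ?] := Hp a ard; have /andP[? ?] := Hp' a ard.
  by apply/andP; split; [apply: conv_gt | apply: conv_lt].
move=> a0; rewrite act_affine !pairQ_conv -subr_gt0.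
have := Kp a ard a0; have := Kp' a ard a0.
rewrite -subr_gt0 => h1; rewrite -subr_gt0 => h2.
by have := conv_gt t01 h2 h1; lra.
Qed.

Lemma fundamental_open q0 : opened (fundamental q0).
Proof.
move=> p u [Hp Kp]; apply: small_enough_and.
  apply: small_enough_all => a /Hp /andP[H1 H2].
  have := small_enough_and (small_enough_lt 0 (pairQ a.1 u) H1)
    (small_enough_lt (pairQ a.1 u) 0 H2).
  apply: small_enough_imp => e _; rewrite !mulr0 !addr0 pairQD pairQZ.
  by case=> -> ->.
apply: small_enough_all => a ard; have [a0|a0] := ltP 0 (pairing a.1 mu); last by exists 1.
have := small_enough_lt (pairQ a.1 u) (pairQ (ract x.2 a).1 u) (Kp a ard a0).
apply: small_enough_imp => e _ + _.
by rewrite !pairQ_act !pairQD !pairQZ addrAC.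
Qed.

Lemma act_rdmu_box q0 z : generic rd q0 -> good q0 ->
  (forall a, a \in rdmu -> (fl a q0)%:~R < pairQ a.1 z < (fl a q0)%:~R + 1) ->
  forall a, a \in rdmu -> (fl a q0)%:~R < pairQ a.1 (act x z) < (fl a q0)%:~R + 1.
Proof.
move=> gq0 q_good H a amu; rewrite (good_rdmu gq0 q_good amu) fl_act pairQ_act intrD.
have xamu : ract x.2 a \in rdmu by case: rdmu_preserves => _; apply.
by have /andP[h1 h2] := H _ xamu; apply/andP; split; lra.
Qed.

Lemma fundamental_good q0 z : generic rd q0 -> good q0 -> generic rd z ->
  fundamental q0 z -> good z.
Proof.
move=> gq0 q_good gz [H K]; apply: fl_good => // a ard.
rewrite le_eqVlt => /predU1P[a0|a0]; last by apply/le_floor/ltW/K.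
have amu : a \in rdmu by rewrite rdmuP ard -a0 eqxx.
have /andP[h1 h2] := H a amu.
have /andP[h3 h4] := act_rdmu_box gq0 q_good H amu.
by rewrite (@flP _ _ _ (fl a q0)) ?(@flP _ _ (act x z) (fl a q0)) // ltW.
Qed.

(** Iterated midpoints may hit hyperplanes, so [q] is first moved by [e *: mu]. This adds the same
    [e * pairing a.1 mu] to [a] at every iterate: nonorthogonal roots become non-integral, while
    roots of [rdmu] keep their values, strictly between integers by [box]. *)
Lemma to_fundamental q0 q : generic rd q0 -> good q0 -> generic rd q -> good q ->
  same_alcove rdmu q0 q ->
  exists z, [/\ generic rd z, fundamental q0 z & gallery rd good q z].
Proof.
move=> gq0 q0_good gq q_good qq.
have box N : forall a, a \in rdmu ->
    (fl a q0)%:~R < pairQ a.1 (iter N mid q) < (fl a q0)%:~R + 1.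
  elim: N => [|N IH] a amu.
    rewrite qq //= (fl_lt gq (rdmu_sub amu)).
    by have /andP[] := fl_bounds a q.
  have /andP[? ?] := IH a amu; have /andP[? ?] := act_rdmu_box gq0 q0_good IH amu.
  by rewrite /= pairQ_conv; apply/andP; split; [apply: conv_gt|apply: conv_lt].
have [M MP] := speed_mid_pos q.
pose q_ e : point := q + e *: map_mx intr mu.
have shift N e a : a \in rd -> pairQ a.1 (iter N mid (q_ e)) =
    pairQ a.1 (iter N mid q) + e * (pairing a.1 mu)%:~R.
  elim: N a => [|N IH] a ard; first by rewrite /= pairQD pairQZ pairQ_intr.
  by rewrite /= !pairQ_conv !pairQ_act !IH ?ract_rd // pairing_ract_mu //; field.
have genN : small_enough (fun e => {in iota 0 M.+1, forall N, generic rd (iter N mid (q_ e))}).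
  apply: small_enough_all => N _.
  suff : small_enough (fun e => {in rd, forall a, forall k : int,
      pairQ a.1 (iter N mid q) + e * (pairing a.1 mu)%:~R != k%:~R}).
    by apply: small_enough_imp => e _ H a k ard; rewrite shift ?H.
  apply: small_enough_all => a ard; apply: small_enough_nonint.
  have [a0|a0] := eqVneq (pairing a.1 mu) 0; last by right; rewrite intr_eq0.
  left=> k; have amu : a \in rdmu by rewrite rdmuP ard a0 eqxx.
  apply/eqP => E; have := box N a amu; rewrite E ltr_int.
  by rewrite -[_ + 1]/(_ + 1%:~R) -intrD ltr_int; lia.
have /small_enough_ex[e e0 [gN same_q]] :=
  small_enough_and genN (small_enough_same (map_mx intr mu) gq).
have gN' N : (N <= M)%N -> generic rd (iter N mid (q_ e)).
  by move=> NM; apply: gN; rewrite mem_iota.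
have qe_good : good (q_ e) := good_same same_q q_good.
have [G _] := gallery_iter_mid qe_good gN'.
exists (iter M mid (q_ e)); split.
- exact: gN'.
- split=> a ard.
    have := box M a ard; rewrite shift ?rdmu_sub //.
    by move: ard; rewrite rdmuP => /andP[_ /eqP->]; rewrite mulr0 addr0.
  move=> a0; rewrite pairQ_act !shift ?ract_rd // pairing_ract_mu //.
  by have := MP a ard a0; rewrite pairQ_act; lra.
- by apply: gallery_trans G; apply: gallery_same => //; apply: (gN' 0%N).
Qed.

Lemma gallery_rev (U : point -> Prop) p q : gallery rd U p q -> gallery rd U q p.
Proof.
elim=> {p q} [p q up uq gp gq pq|a k p q up uq A|q p r _ IH1 _ IH2].
- by apply: gallery_same => //; apply: same_sym.
- exact: gallery_adj (adj_sym RD A).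
- exact: gallery_trans IH2 IH1.
Qed.

Lemma good_connected q q' : generic rd q -> generic rd q' -> good q -> good q' ->
  same_alcove rdmu q q' -> gallery rd good q q'.
Proof.
move=> gq gq' q_good q_good' qq.
have [z [gz Fz Gz]] := to_fundamental gq q_good gq q_good (fun a _ => erefl).
have [z' [gz' Fz' Gz']] := to_fundamental gq q_good gq' q_good' qq.
apply: gallery_trans Gz _; apply: gallery_trans (gallery_rev Gz').
apply: (@gallery_sub _ _ (fundamental q)) => [r|].
  exact: fundamental_good.
apply: gallery_convex => //; [exact: fundamental_convex | exact: fundamental_open].
Qed.

End NewtonPoint.

(** * From galleries to cyclic shifts *)

Section ExtendedAffineWeylGroup.
Variable n : nat.
Notation root := ('rV[int]_n * 'rV[int]_n)%type.
Notation point := 'rV[rat]_n.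
Variables (rd : seq root) (v : 'rV[int]_n).
Hypotheses (RD : is_root_datum rd) (Rv : regular rd v).
Implicit Types (a b : root) (p q : point) (x y g h : elt n) (w : 'M[int]_n).

Lemma mul_linear w w' : mul (0, w) (0, w') = (0, w' *m w) :> elt n.
Proof. by rewrite /mul /= mul0mx addr0. Qed.

Lemma inW0_gen w : inW0 rd w -> gen (is_refl rd) (0, w).
Proof.
elim=> {w} [|a w ard _ IH]; first exact: gen_one.
rewrite -mul_linear; apply: gen_mul => //; apply: gen_sub.
by exists a, 0; rewrite /aff_refl scale0r.
Qed.

Lemma inQ_gen l : inQ rd l -> gen (is_refl rd) (l, 1%:M).
Proof.
elim=> {l} [|a l ard _ IH]; first exact: gen_one.
have -> : (l + a.2, 1%:M) = mul (a.2, 1%:M) (l, 1%:M) :> elt n.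
  by rewrite /mul /= !mulmx1.
apply: gen_mul => //.
(* Translation by a coroot is the product of two reflections in parallel hyperplanes. *)
have -> : (a.2, 1%:M) = mul (aff_refl a 1) (aff_refl a 0) :> elt n.
  by rewrite /mul /= (sref_sqr RD) // scale0r mul0mx add0r scale1r.
by apply: gen_mul; apply: gen_sub; eexists; eexists; split; eauto.
Qed.

Lemma inW_gen y : inW rd y -> gen (is_refl rd) y.
Proof.
case: y => l w [/inQ_gen lQ /inW0_gen wW].
have -> : (l, w) = mul (l, 1%:M) (0, w) :> elt n.
  by rewrite /mul /= mul0mx add0r mulmx1.
exact: gen_mul.
Qed.

Lemma preserves_linear g : preserves rd (0, g.2) -> preserves rd g.
Proof. by case=> gu gP; split. Qed.

Lemma inWt_preserves Om x : is_diagram_group rd v Om -> inWt rd Om x ->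
  preserves rd x.
Proof.
case=> _ _ OmP [w0 [om [w0W omOm e]]]; apply: preserves_linear.
rewrite e -mul_linear; apply: (preserves_mul (g := (0, om))).
  have [om' om'Om [e1 e2 _]] := OmP om omOm.
  have omu : om \in unitmx by case/mulmx1_unit: e1.
  have om'u : om' \in unitmx by case/mulmx1_unit: e1.
  split=> // a ard.
  (* The condition is taken for the inverse [om'], since [ract om] moves coroots by the inverse of
     [om]. *)
  have [om'' _ [e3 _ H]] := OmP om' om'Om.
  have e4 : om'' = om by rewrite -[om'']mul1mx -e1 -mulmxA e3 mulmx1.
  have e5 : invmx om = om' by rewrite -[RHS]mul1mx -(mulVmx omu) -mulmxA e1 mulmx1.
  by have [+ _] := H a ard; rewrite /ract /= e5 e4.
exact: (gen_refl_preserves RD (inW0_gen w0W)).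
Qed.

(** Only [a] and its opposite contribute to [dist], one each, so the length is 1. If [a] is
    negative, the opposite root describes the same reflection. *)
Lemma wall_ell p s : inAlcove rd v p -> wall rd p s -> inS rd v s.
Proof.
move=> pA sW; have [a [k [e A]]] := sW.
have sP : preserves rd s.
  by apply: (gen_refl_preserves RD); apply: gen_sub; apply: wall_refl sW.
have l1 : ell rd v s = 1%N.
  have := ell_dist RD Rv sP pA.
  have [ard gp gq [ap aq] H] := A.
  have oard := ropp_rd RD ard.
  have oa : ropp a \in rem a rd.
    rewrite (rem_filter a (uniq_rd RD)) mem_filter oard andbT /=.
    apply/eqP => /(congr1 fst) /= /(congr1 (fun z => pairing z a.2)).
    by rewrite pairingNl (pairing2 RD).
  rewrite /dist (big_rem a ard) /= (big_rem (ropp a) oa) /=.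
  rewrite (fl_ropp gp ard) (fl_ropp gq ard) ap aq big1_seq; first by lia.
  move=> b; rewrite /= (rem_filter _ (rem_uniq _ (uniq_rd RD))) mem_filter /=.
  rewrite (rem_filter a (uniq_rd RD)) mem_filter /= => /and3P[n2 n1 brd].
  by rewrite H // subrr.
have [ard _ _ _ _] := A.
have [apos|aneg] := boolP (positive v a); first by exists a, k.
exists (ropp a), (- k); split=> //; first exact: ropp_rd.
  by rewrite (positive_ropp Rv).
by rewrite aff_refl_ropp.
Qed.

Lemma reach_trans x y g : reach rd v x y -> reach rd v y g -> reach rd v x g.
Proof. by elim=> // s x' y' z st _ IH /IH; apply: reach_step st. Qed.

(** The inverse stands on the left so that [conj x g] acts on the base alcove as [x] does on its
    image under [g]. *)
Definition conj x g := mul (inv g) (mul x g).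

Lemma preserves_conj x g : preserves rd x -> preserves rd g -> preserves rd (conj x g).
Proof.
by move=> xP gP; do !apply: preserves_mul => //; apply: preserves_inv.
Qed.

Lemma conj_mul x g h : g.2 \in unitmx -> h.2 \in unitmx ->
  conj x (mul g h) = conj (conj x g) h.
Proof. by move=> gu hu; rewrite /conj invg_mul // !mulA. Qed.

Lemma ell_conj x g p : preserves rd x -> preserves rd g -> inAlcove rd v p ->
  (2 * ell rd v (conj x g) = dist rd (act g p) (act x (act g p)))%N.
Proof.
move=> xP gP pA; rewrite -(ell_dist RD Rv _ pA); last exact: preserves_conj.
rewrite -(dist_act RD _ _ gP) -!actM /conj mulKVg //; by case: gP.
Qed.

Lemma pow_conj x g m : g.2 \in unitmx -> pow (conj x g) m = conj (pow x m) g.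
Proof.
move=> gu; elim: m => [|m IH]; first by rewrite /conj mul1g mulVg.
by rewrite !powS IH /conj -!mulA mulKVg.
Qed.

Hypothesis red : reduced rd.

Section Straight.
Variables (x : elt n) (m : nat) (p : point).
Hypotheses (xP : preserves rd x) (m0 : (0 < m)%N).
Hypotheses (xm : {in rd, forall a, ract (pow x m).2 a = a}) (pA : inAlcove rd v p).

(** Goodness at both ends forces both lengths, times [2 m], to equal [drift], so conjugation by [s]
    keeps the length. *)
Lemma good_step g s q q' : preserves rd g -> wall rd p s ->
  good rd x m q -> good rd x m q' ->
  same_alcove rd (act g p) q -> same_alcove rd (act (mul g s) p) q' ->
  reach rd v (conj x g) (conj x (mul g s)).
Proof.
move=> gP sW gq gq' sq sq'.
have [a [k [e [ard _ _ _ _]]]] := sW.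
have sP : preserves rd s by rewrite e; apply: preserves_refl.
have xP' := @same_act _ rd x.
apply: (reach_step (s := s)) (reach_refl _ _ _); split.
- exact: wall_ell pA sW.
- rewrite conj_mul; [|by case: gP|by case: sP].
  by rewrite {1}/conj {1}e (inv_aff_refl RD) // -e mulA.
have gsP := preserves_mul gP sP.
have e1 : (m * (2 * ell rd v (conj x g)) = drift rd x m)%N.
  by rewrite (ell_conj xP gP pA) (dist_same sq (xP' _ _ xP sq)); apply: goodE.
have e2 : (m * (2 * ell rd v (conj x (mul g s))) = drift rd x m)%N.
  by rewrite (ell_conj xP gsP pA) (dist_same sq' (xP' _ _ xP sq')); apply: goodE.
by move/eqP: e2; rewrite -e1 !eqn_pmul2l // => /eqP->.
Qed.

(** Replacing [y] by [z y] with [z] commuting with [x] leaves [conj x y] unchanged and brings both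
    good alcoves into one alcove of [rdmu]. A gallery of good alcoves joins them there, and its word
    [h] equals [z y] by simple transitivity. *)
Lemma good_reach y : gen (is_refl rd) y -> good rd x m p -> good rd x m (act y p) ->
  reach rd v x (conj x y).
Proof.
move=> yW p_good yp_good.
have gp := alcove_generic RD Rv pA.
have yP := gen_refl_preserves RD yW.
have gyp := generic_act yP gp.
have [z [zW xz zyp]] := centralizer_transitive RD red xP m0 xm gyp gp yp_good p_good.
have zW' : gen (is_refl rd) z.
  move: z zW {xz zyp}; apply: gen_trans => _ [a [k [ard ->]]].
  by apply: gen_sub; exists a, k; split=> //; apply: rdmu_sub ard.
have zP := gen_refl_preserves RD zW'.
have zyp_good := mulg_good RD zP xz yp_good.
have G := good_connected RD red xP m0 xm gp (generic_act zP gyp) p_good zyp_good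
  (same_sym zyp).
have one_p : same_alcove rd (act (one n) p) p by rewrite act1.
have [h [hW hp R]] := @gallery_follow _ rd RD (good rd x m)
  (fun g h => reach rd v (conj x g) (conj x h)) p gp (fun g => reach_refl _ _ _)
  (fun g h k => @reach_trans _ _ _) good_step _ _ G _ (preserves_one rd) one_p.
have hP := gen_wall_preserves RD hW.
have yu : y.2 \in unitmx by case: yP.
have zu : z.2 \in unitmx by case: zP.
have zyu := unitmx_mulg zu yu.
have E : h = mul z y.
  have hW' : gen (is_refl rd) h.
    by move: h hW {R hp hP}; apply: gen_trans => g /wall_refl; apply: gen_sub.
  rewrite -[h](mulKVg _ zyu).
  suff -> : mul (inv (mul z y)) h = one n by rewrite mulg1.
  apply: (refl_free RD red gp).
    by apply: gen_mul => //; apply: gen_refl_inv RD _ _; apply: gen_mul.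
  rewrite mul1g -actM in hp.
  have := same_act (preserves_inv RD (preserves_mul zP yP)) hp.
  by rewrite -!actM mulVg // act1.
have x1 : conj x (one n) = x by rewrite /conj mulg1 -(@inv_uniq _ (one n) (one n)) ?mul1g //= unitmx1.
have xz' : conj x z = x by rewrite /conj xz mulKg.
by move: R; rewrite mul1g E conj_mul // xz' x1.
Qed.

End Straight.

End ExtendedAffineWeylGroup.

Theorem theorem3p13 (n : nat) (rd : seq ('rV[int]_n * 'rV[int]_n)) (v : 'rV[int]_n)
  (Om : seq 'M[int]_n) (x0 : elt n) :
  is_root_datum rd -> reduced rd -> regular rd v -> is_diagram_group rd v Om ->
  inWt rd Om x0 -> straight_class rd v x0 ->
  forall x x', inOmin rd v x0 x -> inOmin rd v x0 x' -> approx rd v x x'.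
Proof.
move=> RD red Rv OmP x0W [xs [xsO xs_straight]].
have [c [/inW_gen cW' exs]] := xsO; have cW := cW' RD.
have x0P := inWt_preserves RD OmP x0W.
have cP := gen_refl_preserves RD cW.
have cu : c.2 \in unitmx by case: cP.
suff main x x' : inOmin rd v x0 x -> inOmin rd v x0 x' -> reach rd v x x'.
  by move=> x x' xO xO'; split; apply: main.
case=> [[y [yW ex]] x_min] [[y' [y'W ex']] x_min'].
have {}yW := inW_gen RD yW; have {}y'W := inW_gen RD y'W.
have yP := gen_refl_preserves RD yW; have y'P := gen_refl_preserves RD y'W.
have yu : y.2 \in unitmx by case: yP.
have y'u : y'.2 \in unitmx by case: y'P.
have xP : preserves rd x.
  rewrite ex; apply: preserves_mul; last exact: preserves_inv.
  exact: preserves_mul.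
(* From here [x] serves as the base point of the class. *)
have x0E : x0 = conj x y by rewrite /conj ex mulgKV // mulKg.
have conjE d : d.2 \in unitmx ->
    mul (mul d x0) (inv d) = conj x (mul y (inv d)).
  by move=> du; rewrite conj_mul ?unitmx_invg // -x0E /conj invgK // mulA.
have xsE := conjE c cu; have x'E := conjE y' y'u.
rewrite -exs in xsE; rewrite -ex' in x'E.
have ycW : gen (is_refl rd) (mul y (inv c)).
  by apply: gen_mul => //; apply: gen_refl_inv.
have yy'W : gen (is_refl rd) (mul y (inv y')).
  by apply: gen_mul => //; apply: gen_refl_inv.
have ycP := gen_refl_preserves RD ycW; have yy'P := gen_refl_preserves RD yy'W.
have [p pA] := exists_alcove rd v.
have [m m0 xm] := pow_fix_roots xP.
(* Straightness enters here: [m] times the length of [xs] is the length of [xs ^ m], a conjugate of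
   [x ^ m], and [x ^ m] moves every point by distance [drift]. *)
have xs_len : (m * (2 * ell rd v xs) = drift rd x m)%N.
  rewrite mulnCA -xs_straight xsE pow_conj; last by case: ycP.
  rewrite (ell_conj RD Rv _ ycP pA) //; last exact: preserves_pow.
  by rewrite act_pow drift_dist.
(* Both [x] and [x'] are at most as long as [xs], so the base alcove and its image under
   [mul y (inv y')] are good. *)
rewrite x'E; apply: (good_reach RD Rv red xP m0 xm pA) => //.
  rewrite /good -xs_len (ell_dist RD Rv xP pA) !leq_mul2l; apply/orP; right.
  exact: x_min.
rewrite /good -xs_len -(ell_conj RD Rv xP yy'P pA) -x'E !leq_mul2l.
by apply/orP; right; apply: x_min'.
Qed.
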